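(* Let $U\subset\mathbb{C}$ be open. Let $\{F_t\}_{t\ge0}$ and $\{H_t\}_{t\ge0}$ be families of analytic maps $F_t:U\to U$, $H_t:U\to U$ such that: - $F_0(z)=z$ and $H_0(z)=z$; - $F_{t+s}(z)=F_t(F_s(z))$ and $H_{t+s}(z)=H_t(F_s(z))-F_s(z)+H_s(z)$ for all $s,t\ge0$, $z\in U$; - $(t,z)\mapsto F_t(z)$ and $(t,z)\mapsto H_t(z)$ are continuous on $[0,\infty)\times U$. Then there exist analytic functions $A_1,A_2$ on $U$ such that $$\frac{d}{dt}H_t(z)=A_1(F_t(z)),\qquad \frac{d}{dt}F_t(z)=A_2(F_t(z))$$ for all $z\in U$ and $t\in[0,\infty)$. *)

(* Defs.v *)
From Stdlib Require Import Reals.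
From Coquelicot Require Import Coquelicot.
Open Scope R_scope.

Definition analytic_on (U : C -> Prop) (f : C -> C) : Prop :=
  forall z : C, U z -> ex_derive (K := C_AbsRing) (V := C_NormedModule) f z.

(* derivative of g : [0,oo) -> C at t >= 0, taken within [0,oo)
   (two-sided for t > 0, right derivative at t = 0) *)
Definition has_tderiv (g : R -> C) (t : R) (l : C) : Prop :=
  filterlim (fun h : R => scal (/ h) (minus (g (t + h)) (g t)))
    (within (fun h : R => h <> 0 /\ 0 <= t + h) (locally 0))
    (locally l).

Definition jointly_continuous_on (U : C -> Prop) (G : R -> C -> C) : Prop :=
  forall (t : R) (z : C), 0 <= t -> U z ->
    filterlim (fun p : R * C => G (fst p) (snd p))
      (within (fun p : R * C => 0 <= fst p /\ U (snd p)) (locally (t, z)))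
      (locally (G t z)).

(* Main.v *)
Require Import Defs.
From Stdlib Require Import Reals Lra ClassicalEpsilon.
From Coquelicot Require Import Coquelicot.
Open Scope R_scope.

(** Average the flow in time: [G_h z = int_0^h F_s z ds]. The semigroup law gives
    [G_h (F_t z) = int_t^(t+h) F_s z ds], which is differentiable in [t] with derivative
    [F_h w - w], where [w = F_t z]. Since [G_h' / h] tends to [1] as [h] tends to [0], [G_h'] does
    not vanish near a given point once [h] is small, so [F_t z] is itself differentiable, with
    derivative [A2 w = (F_h w - w) / G_h' w].

    [K_t z = H_t z - z] is an additive cocycle over the flow, so that, with
    [M_h z = int_0^h K_s z ds], one has [h K_t z = int_t^(t+h) K_s z ds - M_h (F_t z)] and
    [A1 w = (K_h w - M_h' w * A2 w) / h].

    "Analytic" is pointwise complex differentiability, so the holomorphy of [G_h], [M_h] and of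
    their derivatives rests on Cauchy's formula. It is obtained on squares from Goursat's
    theorem. The winding number of a square is only shown to be constant and nonzero. *)

(** In time, [F] and [H] are only known to be continuous, so a time derivative has to come from the
    fundamental theorem of calculus: averaging moves [t] into the endpoints of an integral, and
    holomorphy in space carries the resulting derivative back to [F] and [H]. The threshold on [h]
    depends on the point, since the families are bounded only locally; one [h] therefore yields
    generators near one point only. The local formulas agree on overlaps because their value at [w]
    must be the derivative at time 0 of the orbit through [w], in which [h] does not occur. This
    also tells how to define [A1] and [A2] globally. Differentiation under the time integral is done
    through a second-order Taylor bound whose constant depends on the function only through a bound
    for its modulus; it then holds for all small times at once. Cauchy's formula is used after
    division by the winding integral, so a lower bound on that integral replaces the evaluation
    [2 pi i]. *)

Notation is_cderiv := (is_derive (K := C_AbsRing) (V := C_NormedModule)).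
Notation ex_cderiv := (ex_derive (K := C_AbsRing) (V := C_NormedModule)).
Notation is_rderiv := (is_derive (K := R_AbsRing) (V := C_R_NormedModule)).

(** * Epsilon forms of differentiability and continuity, and rules for complex derivatives *)

Lemma Cmod_minus_sym (z w : C) : Cmod (z - w) = Cmod (w - z).
Proof. rewrite <- Cmod_opp; f_equal; ring. Qed.

Lemma Cmod_triangle3 (x y z : C) : Cmod (x - z) <= Cmod (x - y) + Cmod (y - z).
Proof. replace (x - z)%C with ((x - y) + (y - z))%C by ring. apply Cmod_triangle. Qed.

Lemma Cmod_minus_le (x y : C) : Cmod (x - y) <= Cmod x + Cmod y.
Proof. unfold Cminus. rewrite <- (Cmod_opp y). apply Cmod_triangle. Qed.

Lemma Cmod_triangle_sub (x y : C) : Cmod x - Cmod y <= Cmod (x - y).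
Proof.
  assert (Hx := Cmod_triangle (x - y) y).
  replace (x - y + y)%C with x in Hx by ring. lra.
Qed.

Lemma Cmod_minus_diag (z : C) : Cmod (z - z) = 0.
Proof. replace (z - z)%C with (RtoC 0) by ring. apply Cmod_0. Qed.

Lemma Cmod_fst (z : C) : Rabs (fst z) <= Cmod z.
Proof. eapply Rle_trans; [apply Rmax_l | apply Rmax_Cmod]. Qed.

Lemma Cmod_snd (z : C) : Rabs (snd z) <= Cmod z.
Proof. eapply Rle_trans; [apply Rmax_r | apply Rmax_Cmod]. Qed.

Lemma Cmod_fst_minus (z w : C) : Rabs (fst z - fst w) <= Cmod (z - w).
Proof. exact (Cmod_fst (z - w)). Qed.

Lemma Cmod_snd_minus (z w : C) : Rabs (snd z - snd w) <= Cmod (z - w).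
Proof. exact (Cmod_snd (z - w)). Qed.

Lemma Cmod_le_abs (z : C) : Cmod z <= Rabs (fst z) + Rabs (snd z).
Proof.
  replace z with (RtoC (fst z) + Ci * RtoC (snd z))%C at 1.
  - eapply Rle_trans; [apply Cmod_triangle|].
    rewrite Cmod_mult, !Cmod_R, Cmod_Ci; lra.
  - destruct z as [x y]; unfold RtoC, Ci, Cplus, Cmult; simpl; f_equal; ring.
Qed.

Lemma locally_C_Cmod (z : C) (P : C -> Prop) :
  @locally C_UniformSpace z P <->
  exists d, 0 < d /\ forall w, Cmod (w - z) < d -> P w.
Proof.
  split.
  - intros HP. destruct (proj1 (locally_C z P) HP) as [d Hd].
    exists d; split; [apply cond_pos|]. intros w Hw; apply Hd; exact Hw.
  - intros [d [d0 Hd]]. apply (proj2 (locally_C z P)).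
    exists (mkposreal d d0); intros w Hw; apply Hd; exact Hw.
Qed.

Lemma is_cderiv_eps (f : C -> C) (z l : C) :
  is_cderiv f z l <->
  forall eps, 0 < eps -> exists d, 0 < d /\
    forall w, Cmod (w - z) < d -> Cmod (f w - f z - l * (w - z)) <= eps * Cmod (w - z).
Proof.
  split.
  - intros [_ Hd] eps e0.
    destruct (Hd z (fun P HP => HP) (mkposreal eps e0)) as [d Hw].
    exists d; split; [apply cond_pos|]. intros w Hwz.
    specialize (Hw w Hwz). rewrite Cmult_comm. exact Hw.
  - intros Hd; split; [exact (is_linear_scal_l (K := C_AbsRing) (V := C_NormedModule) l)|].
    intros x Hx.
    assert (x = z) as -> by (symmetry; apply (is_filter_lim_locally_unique (K := C_AbsRing)
      (V := AbsRing_NormedModule C_AbsRing)); exact Hx).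
    intros eps. destruct (Hd eps (cond_pos eps)) as [d [d0 Hw]].
    exists (mkposreal d d0). intros w Hwz. specialize (Hw w Hwz).
    rewrite Cmult_comm in Hw. exact Hw.
Qed.

Lemma norm_C_R (z : C) : @norm R_AbsRing C_R_NormedModule z = Cmod z.
Proof. symmetry; exact (Cmod_norm z). Qed.

Lemma is_rderiv_eps (f : R -> C) (t : R) (l : C) :
  is_rderiv f t l <->
  forall eps, 0 < eps -> exists d, 0 < d /\
    forall s, Rabs (s - t) < d -> Cmod (f s - f t - RtoC (s - t) * l) <= eps * Rabs (s - t).
Proof.
  split.
  - intros [_ Hd] eps e0.
    destruct (Hd t (fun P HP => HP) (mkposreal eps e0)) as [d Hw].
    exists d; split; [apply cond_pos|]. intros s Hs.
    specialize (Hw s Hs). rewrite norm_C_R in Hw. rewrite <- scal_R_Cmult. exact Hw.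
  - intros Hd; split; [exact (is_linear_scal_l (K := R_AbsRing) (V := C_R_NormedModule) l)|].
    intros x Hx.
    assert (x = t) as -> by (symmetry; apply (is_filter_lim_locally_unique (K := R_AbsRing)
      (V := AbsRing_NormedModule R_AbsRing)); exact Hx).
    intros eps. destruct (Hd eps (cond_pos eps)) as [d [d0 Hw]].
    exists (mkposreal d d0). intros s Hs. specialize (Hw s Hs).
    rewrite <- scal_R_Cmult in Hw. rewrite norm_C_R. exact Hw.
Qed.

Lemma continuous_RC_eps (f : R -> C) (t : R) :
  continuous (U := C_UniformSpace) f t <->
  forall eps, 0 < eps -> exists d, 0 < d /\
    forall s, Rabs (s - t) < d -> Cmod (f s - f t) < eps.
Proof.
  split.
  - intros Hc eps e0.
    destruct (Hc (fun w => Cmod (w - f t) < eps)) as [d Hd].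
    + apply locally_C_Cmod. exists eps; split; [exact e0 | tauto].
    + exists d; split; [apply cond_pos|]. intros s Hs; apply Hd; exact Hs.
  - intros Hc P HP. apply locally_C_Cmod in HP. destruct HP as [e [e0 He]].
    destruct (Hc e e0) as [d [d0 Hd]].
    exists (mkposreal d d0). intros s Hs. apply He, Hd, Hs.
Qed.

Lemma ex_cderiv_cont (f : C -> C) (z : C) : ex_cderiv f z ->
  forall eps, 0 < eps -> exists d, 0 < d /\ forall w, Cmod (w - z) < d -> Cmod (f w - f z) < eps.
Proof.
  intros [l Hl] eps e0. rewrite is_cderiv_eps in Hl.
  destruct (Hl 1 Rlt_0_1) as [d [d0 Hd]].
  assert (Hl0 := Cmod_ge_0 l).
  exists (Rmin d (eps / (2 + Cmod l))). split.
  - apply Rmin_glb_lt; [exact d0 | apply Rdiv_lt_0_compat; lra].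
  - intros w Hw.
    assert (Hw1 : Cmod (w - z) < d) by (eapply Rlt_le_trans; [exact Hw | apply Rmin_l]).
    assert (Hw2 : Cmod (w - z) < eps / (2 + Cmod l))
      by (eapply Rlt_le_trans; [exact Hw | apply Rmin_r]).
    specialize (Hd w Hw1).
    assert (Ht := Cmod_triangle_sub (f w - f z) (l * (w - z))).
    rewrite Cmod_mult in Ht.
    apply (Rmult_lt_compat_r (2 + Cmod l)) in Hw2; [|lra].
    unfold Rdiv in Hw2. rewrite Rmult_assoc, Rinv_l, Rmult_1_r in Hw2 by lra.
    assert (H0 := Cmod_ge_0 (w - z)). nra.
Qed.

Lemma is_cderiv_inv (z : C) : z <> 0%C -> is_cderiv (fun w => Cinv w) z (- / (z * z))%C.
Proof.
  intros Hz. apply is_cderiv_eps. intros eps e0.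
  assert (Hm : 0 < Cmod z) by (apply Cmod_gt_0; exact Hz).
  assert (Hm3 : 0 < Cmod z * Cmod z * Cmod z) by (repeat apply Rmult_lt_0_compat; lra).
  exists (Rmin (Cmod z / 2) (eps * (Cmod z * Cmod z * Cmod z) / 2)). split.
  - apply Rmin_glb_lt; [lra|]. apply Rdiv_lt_0_compat; [nra|lra].
  - intros w Hw.
    assert (Hw1 : Cmod (w - z) < Cmod z / 2)
      by (eapply Rlt_le_trans; [exact Hw | apply Rmin_l]).
    assert (Hw2 : Cmod (w - z) < eps * (Cmod z * Cmod z * Cmod z) / 2)
      by (eapply Rlt_le_trans; [exact Hw | apply Rmin_r]).
    assert (Hwm : Cmod z / 2 < Cmod w).
    { assert (Ht := Cmod_triangle_sub z w). rewrite Cmod_minus_sym in Ht. lra. }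
    assert (Hw0 : w <> 0%C) by (apply Cmod_gt_0; lra).
    replace (/ w - / z - - / (z * z) * (w - z))%C
      with ((w - z) * (w - z) * / (z * z * w))%C by (field; auto).
    rewrite !Cmod_mult, Cmod_inv, !Cmod_mult by (repeat apply Cmult_neq_0; auto).
    assert (H0 := Cmod_ge_0 (w - z)).
    apply (Rmult_le_reg_r (Cmod z * Cmod z * Cmod w)); [nra|].
    rewrite (Rmult_assoc (Cmod (w - z) * _)), Rinv_l, Rmult_1_r by nra.
    replace (eps * Cmod (w - z) * (Cmod z * Cmod z * Cmod w))
      with (Cmod (w - z) * (eps * (Cmod z * Cmod z * Cmod w))) by ring.
    apply Rmult_le_compat_l; [exact H0|].
    assert (eps * (Cmod z * Cmod z * (Cmod z / 2)) <= eps * (Cmod z * Cmod z * Cmod w)).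
    { apply Rmult_le_compat_l; [lra|]. apply Rmult_le_compat_l; nra. }
    nra.
Qed.

Lemma ex_cderiv_const (c z : C) : ex_cderiv (fun _ => c) z.
Proof. exists (RtoC 0). exact (is_derive_const (K := C_AbsRing) (V := C_NormedModule) c z). Qed.

Lemma ex_cderiv_id (z : C) : ex_cderiv (fun w => w) z.
Proof.
  exists (RtoC 1). apply is_cderiv_eps. intros eps e0. exists 1; split; [lra|]. intros w _.
  replace (w - z - 1 * (w - z))%C with (RtoC 0) by ring. rewrite Cmod_0.
  assert (H := Cmod_ge_0 (w - z)). nra.
Qed.

Lemma ex_cderiv_plus (f g : C -> C) (z : C) :
  ex_cderiv f z -> ex_cderiv g z -> ex_cderiv (fun w => f w + g w)%C z.
Proof. exact (ex_derive_plus (K := C_AbsRing) (V := C_NormedModule) f g z). Qed.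

Lemma ex_cderiv_minus (f g : C -> C) (z : C) :
  ex_cderiv f z -> ex_cderiv g z -> ex_cderiv (fun w => f w - g w)%C z.
Proof. exact (ex_derive_minus (K := C_AbsRing) (V := C_NormedModule) f g z). Qed.

Lemma is_cderiv_mult (f g : C -> C) (z df dg : C) :
  is_cderiv f z df -> is_cderiv g z dg ->
  is_cderiv (fun w => f w * g w)%C z (df * g z + f z * dg)%C.
Proof.
  intros Hf Hg.
  (* The product rule lives on [C_AbsRing] as a module over itself; the two module structures give
     the same derivatives. *)
  assert (HH : forall h : C -> C, forall l, is_cderiv h z l <->
    is_derive (K := C_AbsRing) (V := AbsRing_NormedModule C_AbsRing) h z l).
  { intros h l; split; intros [_ Hd]; (split; [apply is_linear_scal_l | exact Hd]). }
  apply HH. apply (is_derive_mult (K := C_AbsRing)).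
  - apply HH; exact Hf.
  - apply HH; exact Hg.
  - exact Cmult_comm.
Qed.

Lemma ex_cderiv_mult (f g : C -> C) (z : C) :
  ex_cderiv f z -> ex_cderiv g z -> ex_cderiv (fun w => f w * g w)%C z.
Proof. intros [a Ha] [b Hb]. eexists. apply is_cderiv_mult; eassumption. Qed.

Lemma is_cderiv_comp (f g : C -> C) (z df dg : C) :
  is_cderiv f (g z) df -> is_cderiv g z dg -> is_cderiv (fun w => f (g w)) z (df * dg)%C.
Proof.
  intros Hf Hg. rewrite Cmult_comm.
  apply (is_derive_comp (K := C_AbsRing) (V := C_NormedModule) f g); [exact Hf|].
  destruct Hg as [_ Hd]; split; [apply is_linear_scal_l | exact Hd].
Qed.

Lemma ex_cderiv_inv (g : C -> C) (z : C) :
  g z <> 0%C -> ex_cderiv g z -> ex_cderiv (fun w => / g w)%C z.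
Proof.
  intros H0 [l Hl]. eexists. apply (is_cderiv_comp Cinv g); [apply is_cderiv_inv, H0 | exact Hl].
Qed.

Lemma ex_cderiv_ext_loc (f g : C -> C) (z : C) (d : R) :
  0 < d -> (forall w, Cmod (w - z) < d -> f w = g w) -> ex_cderiv f z -> ex_cderiv g z.
Proof.
  intros d0 He. apply ex_derive_ext_loc.
  exists (mkposreal d d0). intros w Hw; apply He; exact Hw.
Qed.

Create HintDb cderiv.
#[local] Hint Resolve ex_cderiv_const ex_cderiv_id ex_cderiv_plus ex_cderiv_minus
  ex_cderiv_mult ex_cderiv_inv : cderiv.

(** * Integrals of complex-valued functions of a real variable *)

Notation ex_CInt := (ex_RInt (V := C_R_NormedModule)).
Notation CInt := (RInt (V := C_R_CompleteNormedModule)).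
Notation is_CInt := (is_RInt (V := C_R_NormedModule)).

Lemma CInt_correct (f : R -> C) (a b : R) : ex_CInt f a b -> is_CInt f a b (CInt f a b).
Proof. exact (RInt_correct (V := C_R_CompleteNormedModule) f a b). Qed.

Lemma is_CInt_unique (f : R -> C) (a b : R) (l : C) : is_CInt f a b l -> CInt f a b = l.
Proof. exact (is_RInt_unique (V := C_R_CompleteNormedModule) f a b l). Qed.

Lemma ex_CInt_cont (f : R -> C) (a b : R) : a <= b ->
  (forall t, a <= t <= b -> continuous (U := C_UniformSpace) f t) -> ex_CInt f a b.
Proof.
  intros Hab Hc. apply (ex_RInt_continuous (V := C_R_CompleteNormedModule)).
  rewrite Rmin_left, Rmax_right by exact Hab. exact Hc.
Qed.

Lemma ex_CInt_continuous (g : R -> C) (a b : R) :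
  (forall t, continuous (U := C_UniformSpace) g t) -> ex_CInt g a b.
Proof. intros Hg. apply (ex_RInt_continuous (V := C_R_CompleteNormedModule)). auto. Qed.

Lemma is_CInt_plus (f g : R -> C) (a b : R) (l m : C) :
  is_CInt f a b l -> is_CInt g a b m -> is_CInt (fun x => f x + g x)%C a b (l + m)%C.
Proof. exact (is_RInt_plus (V := C_R_NormedModule) f g a b l m). Qed.

(** The integral is one of a real normed module, so a complex factor is treated through the real and
    imaginary parts of the product. *)
Lemma is_CInt_scal (c : C) (f : R -> C) (a b : R) (l : C) :
  is_CInt f a b l -> is_CInt (fun x => c * f x)%C a b (c * l)%C.
Proof.
  intros Hf.
  assert (H1 := is_RInt_fct_extend_fst (U := R_NormedModule) (V := R_NormedModule) f a b l Hf).
  assert (H2 := is_RInt_fct_extend_snd (U := R_NormedModule) (V := R_NormedModule) f a b l Hf).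
  apply (is_RInt_fct_extend_pair (U := R_NormedModule) (V := R_NormedModule)
    (fun x => c * f x)%C).
  - exact (is_RInt_minus (V := R_NormedModule) _ _ a b _ _
      (is_RInt_scal _ a b (fst c) _ H1) (is_RInt_scal _ a b (snd c) _ H2)).
  - exact (is_RInt_plus (V := R_NormedModule) _ _ a b _ _
      (is_RInt_scal _ a b (fst c) _ H2) (is_RInt_scal _ a b (snd c) _ H1)).
Qed.

Lemma is_CInt_norm (f : R -> C) (a b M : R) (l : C) : a <= b ->
  (forall x, a <= x <= b -> Cmod (f x) <= M) -> is_CInt f a b l -> Cmod l <= (b - a) * M.
Proof.
  intros Hab HM Hl. rewrite <- norm_C_R.
  apply (norm_RInt_le_const (V := C_R_NormedModule) f a b l M Hab); [|exact Hl].
  intros x Hx. rewrite norm_C_R. auto.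
Qed.

Lemma CInt_Chasles (f : R -> C) (a b c : R) :
  ex_CInt f a b -> ex_CInt f b c -> CInt f a c = (CInt f a b + CInt f b c)%C.
Proof.
  intros H1 H2. symmetry. exact (RInt_Chasles (V := C_R_CompleteNormedModule) f a b c H1 H2).
Qed.

Lemma is_CInt_derive (f df : R -> C) (a b : R) : a <= b ->
  (forall x, a <= x <= b -> is_rderiv f x (df x)) ->
  (forall x, a <= x <= b -> continuous (U := C_UniformSpace) df x) ->
  is_CInt df a b (f b - f a)%C.
Proof.
  intros Hab H1 H2.
  apply (is_RInt_derive (V := C_R_CompleteNormedModule) f df a b);
    rewrite Rmin_left, Rmax_right by exact Hab; assumption.
Qed.

Lemma CInt_ext (f g : R -> C) (a b : R) : a <= b ->
  (forall x, a <= x <= b -> f x = g x) -> CInt f a b = CInt g a b.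
Proof.
  intros Hab He. apply (RInt_ext (V := C_R_CompleteNormedModule)).
  rewrite Rmin_left, Rmax_right by exact Hab. intros; apply He; lra.
Qed.

(** Serves to bound the imaginary part of the winding integral from below, edge by edge. *)
Lemma is_CInt_snd_ge (f : R -> C) (s t m : R) (l : C) : s <= t ->
  (forall x, s <= x <= t -> m <= snd (f x)) -> is_CInt f s t l -> (t - s) * m <= snd l.
Proof.
  intros Hst Hm Hf.
  assert (H2 := is_RInt_fct_extend_snd (U := R_NormedModule) (V := R_NormedModule) f s t l Hf).
  apply (is_RInt_le (fun _ => m) (fun x => snd (f x)) s t); [exact Hst | | exact H2 |].
  - exact (is_RInt_const s t m).
  - intros; apply Hm; lra.
Qed.

(** * Integrals along the boundary of a rectangle *)

Lemma is_rderiv_horizontal (P : C -> C) (x y : R) (l : C) :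
  is_cderiv P (x, y) l -> is_rderiv (fun s => P (s, y)) x l.
Proof.
  rewrite is_cderiv_eps, is_rderiv_eps. intros HP eps e0.
  destruct (HP eps e0) as [d [d0 Hd]]. exists d; split; [exact d0|]. intros s Hs.
  assert (E : ((s, y) - (x, y))%C = RtoC (s - x))
    by (unfold Cminus, Cplus, Copp, RtoC; simpl; f_equal; ring).
  specialize (Hd (s, y)). rewrite E, Cmod_R, (Cmult_comm l) in Hd. exact (Hd Hs).
Qed.

Lemma is_rderiv_vertical (P : C -> C) (x y : R) (l : C) :
  is_cderiv P (x, y) l -> is_rderiv (fun s => P (x, s)) y (Ci * l)%C.
Proof.
  rewrite is_cderiv_eps, is_rderiv_eps. intros HP eps e0.
  destruct (HP eps e0) as [d [d0 Hd]]. exists d; split; [exact d0|]. intros s Hs.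
  assert (E : ((x, s) - (x, y))%C = (Ci * RtoC (s - y))%C)
    by (unfold Cminus, Cplus, Copp, Ci, RtoC, Cmult; simpl; f_equal; ring).
  specialize (Hd (x, s)). rewrite E, Cmod_mult, Cmod_Ci, Cmod_R, Rmult_1_l in Hd.
  replace (RtoC (s - y) * (Ci * l))%C with (l * (Ci * RtoC (s - y)))%C by ring.
  exact (Hd Hs).
Qed.

Lemma is_rderiv_continuous (f : R -> C) (t : R) (l : C) :
  is_rderiv f t l -> continuous (U := C_UniformSpace) f t.
Proof.
  intros Hf. apply (ex_derive_continuous (K := R_AbsRing) (V := C_R_NormedModule)).
  exists l; exact Hf.
Qed.

Lemma continuous_horizontal (f : C -> C) (x y : R) :
  ex_cderiv f (x, y) -> continuous (U := C_UniformSpace) (fun s => f (s, y)) x.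
Proof. intros [l Hl]. eapply is_rderiv_continuous, is_rderiv_horizontal, Hl. Qed.

Lemma continuous_vertical (f : C -> C) (x y : R) :
  ex_cderiv f (x, y) -> continuous (U := C_UniformSpace) (fun s => f (x, s)) y.
Proof. intros [l Hl]. eapply is_rderiv_continuous, is_rderiv_vertical, Hl. Qed.

Lemma ex_CInt_horizontal (f : C -> C) (y a b : R) : a <= b ->
  (forall x, a <= x <= b -> ex_cderiv f (x, y)) -> ex_CInt (fun x => f (x, y)) a b.
Proof.
  intros Hab Hf. apply ex_CInt_cont; [exact Hab|].
  intros x Hx'. apply continuous_horizontal, Hf, Hx'.
Qed.

Lemma ex_CInt_vertical (f : C -> C) (x a b : R) : a <= b ->
  (forall y, a <= y <= b -> ex_cderiv f (x, y)) -> ex_CInt (fun y => f (x, y)) a b.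
Proof.
  intros Hab Hf. apply ex_CInt_cont; [exact Hab|].
  intros y Hy'. apply continuous_vertical, Hf, Hy'.
Qed.

Definition box (x1 x2 y1 y2 : R) (z : C) : Prop :=
  x1 <= fst z <= x2 /\ y1 <= snd z <= y2.

Definition box_boundary (x1 x2 y1 y2 : R) (z : C) : Prop :=
  box x1 x2 y1 y2 z /\ (fst z = x1 \/ fst z = x2 \/ snd z = y1 \/ snd z = y2).

(** The counterclockwise contour integral of [f dz]: [dz] is [dx] on horizontal edges and [i dy] on
    vertical ones. *)
Definition rect_int (f : C -> C) (x1 x2 y1 y2 : R) : C :=
  (CInt (fun x => f (x, y1)) x1 x2 + Ci * CInt (fun y => f (x2, y)) y1 y2
   - CInt (fun x => f (x, y2)) x1 x2 - Ci * CInt (fun y => f (x1, y)) y1 y2)%C.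

Section Rectangle.

Variables x1 x2 y1 y2 : R.
Hypothesis Hx : x1 <= x2.
Hypothesis Hy : y1 <= y2.

Let boundary := box_boundary x1 x2 y1 y2.

Lemma boundary_bottom (x : R) : x1 <= x <= x2 -> boundary (x, y1).
Proof. unfold boundary, box_boundary, box; simpl; intros; lra. Qed.
Lemma boundary_top (x : R) : x1 <= x <= x2 -> boundary (x, y2).
Proof. unfold boundary, box_boundary, box; simpl; intros; lra. Qed.
Lemma boundary_left (y : R) : y1 <= y <= y2 -> boundary (x1, y).
Proof. unfold boundary, box_boundary, box; simpl; intros; lra. Qed.
Lemma boundary_right (y : R) : y1 <= y <= y2 -> boundary (x2, y).
Proof. unfold boundary, box_boundary, box; simpl; intros; lra. Qed.

(** Regularity is asked on the boundary only, because the Cauchy kernels integrated later have a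
    pole inside. *)
Lemma ex_CInt_edges (f : C -> C) : (forall z, boundary z -> ex_cderiv f z) ->
  ex_CInt (fun x => f (x, y1)) x1 x2 /\ ex_CInt (fun y => f (x2, y)) y1 y2 /\
  ex_CInt (fun x => f (x, y2)) x1 x2 /\ ex_CInt (fun y => f (x1, y)) y1 y2.
Proof.
  intros Hf. repeat split.
  - apply ex_CInt_horizontal; [exact Hx|]. intros; apply Hf, boundary_bottom; assumption.
  - apply ex_CInt_vertical; [exact Hy|]. intros; apply Hf, boundary_right; assumption.
  - apply ex_CInt_horizontal; [exact Hx|]. intros; apply Hf, boundary_top; assumption.
  - apply ex_CInt_vertical; [exact Hy|]. intros; apply Hf, boundary_left; assumption.
Qed.

Lemma is_rect_int (f : C -> C) (a b c d : C) :
  is_CInt (fun x => f (x, y1)) x1 x2 a -> is_CInt (fun y => f (x2, y)) y1 y2 b ->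
  is_CInt (fun x => f (x, y2)) x1 x2 c -> is_CInt (fun y => f (x1, y)) y1 y2 d ->
  rect_int f x1 x2 y1 y2 = (a + Ci * b - c - Ci * d)%C.
Proof.
  intros Ha Hb Hc Hd. unfold rect_int.
  rewrite (is_CInt_unique _ _ _ _ Ha), (is_CInt_unique _ _ _ _ Hb),
    (is_CInt_unique _ _ _ _ Hc), (is_CInt_unique _ _ _ _ Hd). reflexivity.
Qed.

Lemma rect_int_plus (f g : C -> C) :
  (forall z, boundary z -> ex_cderiv f z) -> (forall z, boundary z -> ex_cderiv g z) ->
  rect_int (fun z => f z + g z)%C x1 x2 y1 y2 =
  (rect_int f x1 x2 y1 y2 + rect_int g x1 x2 y1 y2)%C.
Proof.
  intros Hf Hg.
  destruct (ex_CInt_edges f Hf) as [Fa [Fb [Fc Fd]]].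
  destruct (ex_CInt_edges g Hg) as [Ga [Gb [Gc Gd]]].
  rewrite (is_rect_int (fun z => f z + g z)%C _ _ _ _
    (is_CInt_plus _ _ _ _ _ _ (CInt_correct _ _ _ Fa) (CInt_correct _ _ _ Ga))
    (is_CInt_plus _ _ _ _ _ _ (CInt_correct _ _ _ Fb) (CInt_correct _ _ _ Gb))
    (is_CInt_plus _ _ _ _ _ _ (CInt_correct _ _ _ Fc) (CInt_correct _ _ _ Gc))
    (is_CInt_plus _ _ _ _ _ _ (CInt_correct _ _ _ Fd) (CInt_correct _ _ _ Gd))).
  unfold rect_int. ring.
Qed.

Lemma rect_int_scal (c : C) (f : C -> C) :
  (forall z, boundary z -> ex_cderiv f z) ->
  rect_int (fun z => c * f z)%C x1 x2 y1 y2 = (c * rect_int f x1 x2 y1 y2)%C.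
Proof.
  intros Hf. destruct (ex_CInt_edges f Hf) as [Fa [Fb [Fc Fd]]].
  rewrite (is_rect_int (fun z => c * f z)%C _ _ _ _
    (is_CInt_scal c _ _ _ _ (CInt_correct _ _ _ Fa))
    (is_CInt_scal c _ _ _ _ (CInt_correct _ _ _ Fb))
    (is_CInt_scal c _ _ _ _ (CInt_correct _ _ _ Fc))
    (is_CInt_scal c _ _ _ _ (CInt_correct _ _ _ Fd))).
  unfold rect_int. ring.
Qed.

Lemma rect_int_ext (f g : C -> C) : (forall z, boundary z -> f z = g z) ->
  rect_int f x1 x2 y1 y2 = rect_int g x1 x2 y1 y2.
Proof.
  intros He. unfold rect_int.
  rewrite (CInt_ext (fun x => f (x, y1)) (fun x => g (x, y1)) x1 x2 Hx),
    (CInt_ext (fun x => f (x, y2)) (fun x => g (x, y2)) x1 x2 Hx),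
    (CInt_ext (fun y => f (x1, y)) (fun y => g (x1, y)) y1 y2 Hy),
    (CInt_ext (fun y => f (x2, y)) (fun y => g (x2, y)) y1 y2 Hy); try reflexivity;
  intros; apply He;
  solve [apply boundary_bottom; assumption | apply boundary_top; assumption
        | apply boundary_left; assumption | apply boundary_right; assumption].
Qed.

Lemma rect_int_bound (f : C -> C) (M : R) :
  (forall z, boundary z -> ex_cderiv f z) -> (forall z, boundary z -> Cmod (f z) <= M) ->
  Cmod (rect_int f x1 x2 y1 y2) <= 2 * ((x2 - x1) + (y2 - y1)) * M.
Proof.
  intros Hf HM. destruct (ex_CInt_edges f Hf) as [Fa [Fb [Fc Fd]]].
  assert (Ba := is_CInt_norm _ _ _ M _ Hx (fun x Hx' => HM _ (boundary_bottom x Hx'))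
    (CInt_correct _ _ _ Fa)).
  assert (Bb := is_CInt_norm _ _ _ M _ Hy (fun y Hy' => HM _ (boundary_right y Hy'))
    (CInt_correct _ _ _ Fb)).
  assert (Bc := is_CInt_norm _ _ _ M _ Hx (fun x Hx' => HM _ (boundary_top x Hx'))
    (CInt_correct _ _ _ Fc)).
  assert (Bd := is_CInt_norm _ _ _ M _ Hy (fun y Hy' => HM _ (boundary_left y Hy'))
    (CInt_correct _ _ _ Fd)).
  unfold rect_int.
  eapply Rle_trans; [apply Cmod_minus_le|].
  eapply Rle_trans; [apply Rplus_le_compat_r, Cmod_minus_le|].
  eapply Rle_trans; [apply Rplus_le_compat_r, Rplus_le_compat_r, Cmod_triangle|].
  rewrite !Cmod_mult, Cmod_Ci. lra.
Qed.

(** On each edge the fundamental theorem gives a difference of [P] at two corners, and these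
    differences telescope around the rectangle. Differentiability of [p] supplies the continuity of
    the integrand. *)
Lemma rect_int_primitive (P p : C -> C) :
  (forall z, boundary z -> is_cderiv P z (p z)) -> (forall z, boundary z -> ex_cderiv p z) ->
  rect_int p x1 x2 y1 y2 = 0%C.
Proof.
  intros HP Hp.
  assert (Hh : forall y, (forall x, x1 <= x <= x2 -> boundary (x, y)) ->
    CInt (fun x => p (x, y)) x1 x2 = (P (x2, y) - P (x1, y))%C).
  { intros y Hb. apply is_CInt_unique.
    apply (is_CInt_derive (fun x => P (x, y))); [exact Hx| |].
    - intros x Hx'. apply (is_rderiv_horizontal P x y). apply HP, Hb, Hx'.
    - intros x Hx'. apply continuous_horizontal, Hp, Hb, Hx'. }
  assert (Hv : forall x, (forall y, y1 <= y <= y2 -> boundary (x, y)) ->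
    (Ci * CInt (fun y => p (x, y)) y1 y2)%C = (P (x, y2) - P (x, y1))%C).
  { intros x Hb.
    assert (He : ex_CInt (fun y => p (x, y)) y1 y2)
      by (apply ex_CInt_vertical; [exact Hy | intros; apply Hp, Hb; assumption]).
    rewrite <- (is_CInt_unique _ _ _ _ (is_CInt_scal Ci _ _ _ _ (CInt_correct _ _ _ He))).
    apply is_CInt_unique.
    apply (is_CInt_derive (fun y => P (x, y))); [exact Hy| |].
    - intros y Hy'. apply (is_rderiv_vertical P x y). apply HP, Hb, Hy'.
    - intros y Hy'. apply (continuous_vertical (fun z => Ci * p z)%C).
      apply ex_cderiv_mult; [apply ex_cderiv_const | apply Hp, Hb, Hy']. }
  unfold rect_int.
  rewrite (Hh y1 boundary_bottom), (Hh y2 boundary_top), (Hv x1 boundary_left),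
    (Hv x2 boundary_right). ring.
Qed.

End Rectangle.

(** The cut is traversed twice in opposite directions and cancels; integrability serves to split the
    two edges that the cut meets. *)
Lemma rect_int_split_x (f : C -> C) (x1 x2 x3 y1 y2 : R) : x1 <= x2 <= x3 ->
  (forall x, x1 <= x <= x3 -> ex_cderiv f (x, y1) /\ ex_cderiv f (x, y2)) ->
  rect_int f x1 x3 y1 y2 = (rect_int f x1 x2 y1 y2 + rect_int f x2 x3 y1 y2)%C.
Proof.
  intros [H12 H23] Hf. unfold rect_int.
  rewrite (CInt_Chasles (fun x => f (x, y1)) x1 x2 x3), (CInt_Chasles (fun x => f (x, y2)) x1 x2 x3);
    [ring | | | |]; apply ex_CInt_horizontal; try assumption; intros; apply Hf; lra.
Qed.

Lemma rect_int_split_y (f : C -> C) (x1 x2 y1 y2 y3 : R) : y1 <= y2 <= y3 ->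
  (forall y, y1 <= y <= y3 -> ex_cderiv f (x1, y) /\ ex_cderiv f (x2, y)) ->
  rect_int f x1 x2 y1 y3 = (rect_int f x1 x2 y1 y2 + rect_int f x1 x2 y2 y3)%C.
Proof.
  intros [H12 H23] Hf. unfold rect_int.
  rewrite (CInt_Chasles (fun y => f (x1, y)) y1 y2 y3), (CInt_Chasles (fun y => f (x2, y)) y1 y2 y3);
    [ring | | | |]; apply ex_CInt_vertical; try assumption; intros; apply Hf; lra.
Qed.

(** * Goursat's theorem *)

(** The affine part of [f] at [z0] has a primitive and integrates to zero. With [p] the sum of the
    two sides, the remainder is at most [eps / 2 * p] on a contour of length [2 * p]. *)
Lemma rect_int_small (f : C -> C) (z0 : C) (eps : R) : 0 < eps -> ex_cderiv f z0 ->
  exists d, 0 < d /\ forall x1 x2 y1 y2, box x1 x2 y1 y2 z0 ->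
    (x2 - x1) + (y2 - y1) < d -> (forall z, box x1 x2 y1 y2 z -> ex_cderiv f z) ->
    Cmod (rect_int f x1 x2 y1 y2) <= eps * ((x2 - x1) + (y2 - y1)) ^ 2.
Proof.
  intros e0 [l Hl]. rewrite is_cderiv_eps in Hl.
  destruct (Hl (eps / 2)) as [d [d0 Hd]]; [lra|].
  exists d; split; [exact d0|]. intros x1 x2 y1 y2 [Hbx Hby] Hp Hf.
  assert (Hx : x1 <= x2) by lra. assert (Hy : y1 <= y2) by lra.
  set (p := (x2 - x1) + (y2 - y1)) in *.
  set (aff := fun z => (f z0 + l * (z - z0))%C).
  set (rem := fun z => (f z - aff z)%C).
  assert (Haff : forall z, ex_cderiv aff z) by (intros z; unfold aff; auto with cderiv).
  assert (Hrem : forall z, box_boundary x1 x2 y1 y2 z -> ex_cderiv rem z).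
  { intros z [Hz _]. unfold rem. apply ex_cderiv_minus; auto. }
  assert (E1 : rect_int f x1 x2 y1 y2
    = (rect_int aff x1 x2 y1 y2 + rect_int rem x1 x2 y1 y2)%C).
  { rewrite <- rect_int_plus by auto. apply rect_int_ext; auto.
    intros z _. unfold rem. ring. }
  assert (E2 : rect_int aff x1 x2 y1 y2 = 0%C).
  (* The primitive is a quadratic polynomial, whose first-order remainder is exactly
     [l / 2 * (w - z) * (w - z)]. *)
  { apply (rect_int_primitive x1 x2 y1 y2 Hx Hy
      (fun z => f z0 * z + l / 2 * ((z - z0) * (z - z0)))%C aff); [|auto].
    intros z _. apply is_cderiv_eps. intros e He.
    assert (Hl0 := Cmod_ge_0 (l / 2)).
    exists (e / (1 + Cmod (l / 2))). split; [apply Rdiv_lt_0_compat; lra|].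
    intros w Hw. unfold aff.
    replace (f z0 * w + l / 2 * ((w - z0) * (w - z0)) -
      (f z0 * z + l / 2 * ((z - z0) * (z - z0))) - (f z0 + l * (z - z0)) * (w - z))%C
      with (l / 2 * (w - z) * (w - z))%C by (field; intros H2; apply (f_equal fst) in H2; simpl in H2; lra).
    rewrite !Cmod_mult. assert (Hwz := Cmod_ge_0 (w - z)).
    apply Rmult_le_compat_r; [exact Hwz|].
    apply (Rmult_lt_compat_r (1 + Cmod (l / 2))) in Hw; [|lra].
    unfold Rdiv in Hw. rewrite Rmult_assoc, Rinv_l, Rmult_1_r in Hw by lra. nra. }
  rewrite E1, E2, Cplus_0_l.
  replace (eps * p ^ 2) with (2 * p * (eps / 2 * p)) by field.
  apply rect_int_bound; auto.
  intros z [[Hzx Hzy] _].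
  assert (Hzz : Cmod (z - z0) <= p).
  { eapply Rle_trans; [apply Cmod_le_abs|]. unfold p.
    apply Rplus_le_compat; unfold Cminus, Cplus, Copp; simpl; apply Rabs_le; lra. }
  unfold rem, aff. replace (f z - (f z0 + l * (z - z0)))%C with (f z - f z0 - l * (z - z0))%C by ring.
  eapply Rle_trans; [apply Hd; lra|]. apply Rmult_le_compat_l; lra.
Qed.

(** Pigeonhole: the four quarters add up to the whole integral, so one of them exceeds a fourth of
    the lower bound. *)
Lemma rect_int_quarter (f : C -> C) (x1 x2 y1 y2 m : R) : x1 <= x2 -> y1 <= y2 ->
  (forall z, box x1 x2 y1 y2 z -> ex_cderiv f z) ->
  m < Cmod (rect_int f x1 x2 y1 y2) ->
  exists a b c d, x1 <= a /\ b <= x2 /\ y1 <= c /\ d <= y2 /\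
    b - a = (x2 - x1) / 2 /\ d - c = (y2 - y1) / 2 /\
    m / 4 < Cmod (rect_int f a b c d).
Proof.
  intros Hx Hy Hf Hm.
  set (xm := (x1 + x2) / 2). set (ym := (y1 + y2) / 2).
  assert (Hxm : x1 <= xm <= x2) by (unfold xm; lra).
  assert (Hym : y1 <= ym <= y2) by (unfold ym; lra).
  assert (E : rect_int f x1 x2 y1 y2 =
    (rect_int f x1 xm y1 ym + rect_int f x1 xm ym y2
      + (rect_int f xm x2 y1 ym + rect_int f xm x2 ym y2))%C).
  { rewrite (rect_int_split_x f x1 xm x2 y1 y2 Hxm),
      (rect_int_split_y f x1 xm y1 ym y2 Hym), (rect_int_split_y f xm x2 y1 ym y2 Hym);
      [reflexivity | | |]; intros t Ht; split; apply Hf; unfold box; simpl; lra. }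
  rewrite E in Hm.
  assert (Hs := Rle_trans _ _ _ (Cmod_triangle _ _)
    (Rplus_le_compat _ _ _ _
      (Cmod_triangle (rect_int f x1 xm y1 ym) (rect_int f x1 xm ym y2))
      (Cmod_triangle (rect_int f xm x2 y1 ym) (rect_int f xm x2 ym y2)))).
  destruct (Rlt_dec (m / 4) (Cmod (rect_int f x1 xm y1 ym)));
    [exists x1, xm, y1, ym; repeat split; unfold xm, ym in *; lra|].
  destruct (Rlt_dec (m / 4) (Cmod (rect_int f x1 xm ym y2)));
    [exists x1, xm, ym, y2; repeat split; unfold xm, ym in *; lra|].
  destruct (Rlt_dec (m / 4) (Cmod (rect_int f xm x2 y1 ym)));
    [exists xm, x2, y1, ym; repeat split; unfold xm, ym in *; lra|].
  exists xm, x2, ym, y2; repeat split; unfold xm, ym in *; lra.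
Qed.

Lemma nested_intervals (a b : nat -> R) :
  (forall n, a n <= a (S n)) -> (forall n, b (S n) <= b n) -> (forall n, a n <= b n) ->
  exists x, forall n, a n <= x <= b n.
Proof.
  intros Ha Hb Hab.
  assert (Ha' : forall n k, a n <= a (n + k)%nat).
  { intros n k. induction k as [|k IH]; [rewrite Nat.add_0_r; lra|].
    rewrite Nat.add_succ_r. eapply Rle_trans; [exact IH | apply Ha]. }
  assert (Hb' : forall n k, b (n + k)%nat <= b n).
  { intros n k. induction k as [|k IH]; [rewrite Nat.add_0_r; lra|].
    rewrite Nat.add_succ_r. eapply Rle_trans; [apply Hb | exact IH]. }
  assert (Hc : forall n m, a n <= b m).
  { intros n m. eapply Rle_trans; [apply (Ha' n m)|].
    eapply Rle_trans; [apply Hab|]. rewrite Nat.add_comm. apply Hb'. }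
  destruct (completeness (fun x => exists n, x = a n)) as [x [Hu Hl]].
  - exists (b O). intros x [n ->]. apply Hc.
  - exists (a O), O. reflexivity.
  - exists x. intros n; split.
    + apply Hu. exists n; reflexivity.
    + apply Hl. intros y [m ->]. apply Hc.
Qed.

(** Bisection. Halving the sides divides both the squared size and the lower bound on the integral
    by four, so the inequality [eps * size ^ 2 < Cmod integral] is inherited by some quarter
    forever. At the common point of the nested rectangles it contradicts [rect_int_small]. *)
Theorem Goursat (f : C -> C) (x1 x2 y1 y2 : R) : x1 <= x2 -> y1 <= y2 ->
  (forall z, box x1 x2 y1 y2 z -> ex_cderiv f z) -> rect_int f x1 x2 y1 y2 = 0%C.
Proof.
  intros Hx Hy Hf.
  assert (Heps : forall eps, 0 < eps ->
    Cmod (rect_int f x1 x2 y1 y2) <= eps * ((x2 - x1) + (y2 - y1)) ^ 2).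
  { intros eps e0. apply Rnot_lt_le. intros Hbad0.
    set (Bad := fun s : (R * R) * (R * R) =>
      let a := fst (fst s) in let b := snd (fst s) in
      let c := fst (snd s) in let d := snd (snd s) in
      x1 <= a /\ a <= b /\ b <= x2 /\ y1 <= c /\ c <= d /\ d <= y2 /\
      eps * ((b - a) + (d - c)) ^ 2 < Cmod (rect_int f a b c d)).
    set (Half := fun s s' : (R * R) * (R * R) =>
      fst (fst s) <= fst (fst s') /\ snd (fst s') <= snd (fst s) /\
      fst (snd s) <= fst (snd s') /\ snd (snd s') <= snd (snd s) /\
      snd (fst s') - fst (fst s') = (snd (fst s) - fst (fst s)) / 2 /\
      snd (snd s') - fst (snd s') = (snd (snd s) - fst (snd s)) / 2).
    assert (Hstep : forall s : {s | Bad s}, exists s' : {s | Bad s},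
      Half (proj1_sig s) (proj1_sig s')).
    { intros [[[a b] [c d]] HB]. assert (HB' := HB). unfold Bad in HB'; simpl in HB'.
      destruct HB' as [H1 [H2 [H3 [H4 [H5 [H6 H7]]]]]].
      assert (Hsub : forall z, box a b c d z -> ex_cderiv f z)
        by (intros z [Hz1 Hz2]; apply Hf; unfold box; lra).
      destruct (rect_int_quarter f a b c d _ H2 H5 Hsub H7)
        as [a' [b' [c' [d' [K1 [K2 [K3 [K4 [K5 [K6 K7]]]]]]]]]].
      assert (HB2 : Bad ((a', b'), (c', d'))).
      { unfold Bad; simpl. repeat split; try lra.
        eapply Rle_lt_trans; [|exact K7]. rewrite K5, K6. right. field. }
      exists (exist _ ((a', b'), (c', d')) HB2). unfold Half; simpl. lra. }
    (* Choice assigns to each bad rectangle a bad one of half the size; iterating it from the given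
       rectangle produces the nested sequence. *)
    set (next := fun s => proj1_sig (constructive_indefinite_description _ (Hstep s))).
    assert (HB0 : Bad ((x1, x2), (y1, y2))) by (unfold Bad; simpl; lra).
    set (u := nat_rect (fun _ => {s | Bad s}) (exist _ ((x1, x2), (y1, y2)) HB0)
      (fun _ s => next s)).
    assert (Hu : forall n, Half (proj1_sig (u n)) (proj1_sig (u (S n))))
      by (intros n; exact (proj2_sig (constructive_indefinite_description _ (Hstep (u n))))).
    set (a := fun n => fst (fst (proj1_sig (u n)))). set (b := fun n => snd (fst (proj1_sig (u n)))).
    set (c := fun n => fst (snd (proj1_sig (u n)))). set (d := fun n => snd (snd (proj1_sig (u n)))).
    assert (HB : forall n, x1 <= a n /\ a n <= b n /\ b n <= x2 /\ y1 <= c n /\ c n <= d n /\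
      d n <= y2 /\
      eps * ((b n - a n) + (d n - c n)) ^ 2 < Cmod (rect_int f (a n) (b n) (c n) (d n)))
      by (intros n; exact (proj2_sig (u n))).
    change (forall n, a n <= a (S n) /\ b (S n) <= b n /\ c n <= c (S n) /\ d (S n) <= d n /\
      b (S n) - a (S n) = (b n - a n) / 2 /\ d (S n) - c (S n) = (d n - c n) / 2) in Hu.
    destruct (nested_intervals a b) as [x Hxn];
      [intros n; apply (Hu n) | intros n; apply (Hu n) | intros n; apply (HB n) |].
    destruct (nested_intervals c d) as [y Hyn];
      [intros n; apply (Hu n) | intros n; apply (Hu n) | intros n; apply (HB n) |].
    assert (Hsize : forall n, (b n - a n) + (d n - c n) = ((x2 - x1) + (y2 - y1)) * (/ 2) ^ n).
    { induction n as [|n IH]; [unfold a, b, c, d; simpl; ring|].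
      destruct (Hu n) as [_ [_ [_ [_ [K1 K2]]]]]. rewrite K1, K2. simpl.
      replace ((b n - a n) / 2 + (d n - c n) / 2) with ((b n - a n + (d n - c n)) * / 2) by field.
      rewrite IH. ring. }
    destruct (rect_int_small f (x, y) eps e0) as [del [del0 Hdel]].
    { apply Hf. specialize (Hxn O). specialize (Hyn O). specialize (HB O). unfold box; simpl; lra. }
    (* The extra 1 in the denominator keeps the quotient meaningful for a rectangle reduced to a
       point. *)
    destruct (pow_lt_1_zero (/ 2)) with (y := del / (1 + ((x2 - x1) + (y2 - y1)))) as [N HN].
    { rewrite Rabs_right; lra. }
    { apply Rdiv_lt_0_compat; lra. }
    specialize (HN N (le_n N)).
    assert (HpN : 0 < (/ 2) ^ N) by (apply pow_lt; lra).
    rewrite Rabs_right in HN by lra.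
    apply (Rmult_lt_compat_r (1 + ((x2 - x1) + (y2 - y1)))) in HN; [|lra].
    unfold Rdiv in HN. rewrite Rmult_assoc, Rinv_l, Rmult_1_r in HN by lra.
    destruct (HB N) as [H1 [H2 [H3 [H4 [H5 [H6 H7]]]]]].
    apply (Rlt_not_le _ _ H7). apply Hdel.
    - unfold box; simpl; auto.
    - rewrite Hsize. nra.
    - intros z [Hz1 Hz2]. apply Hf. unfold box; lra. }
  apply Cmod_eq_0. apply Rle_antisym; [|apply Cmod_ge_0].
  apply Rnot_lt_le. intros Hpos.
  set (q := ((x2 - x1) + (y2 - y1)) ^ 2) in *.
  assert (Hq : 0 <= q) by (apply pow2_ge_0).
  (* With this value as [eps], the bound [eps * q] is at most half of the modulus it should
     dominate. *)
  assert (Hr : 0 < Cmod (rect_int f x1 x2 y1 y2) / (2 * (1 + q))) by (apply Rdiv_lt_0_compat; lra).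
  specialize (Heps _ Hr).
  assert (E : Cmod (rect_int f x1 x2 y1 y2)
    = Cmod (rect_int f x1 x2 y1 y2) / (2 * (1 + q)) * (2 * (1 + q))) by (field; lra).
  nra.
Qed.

(** * Cauchy's formula on a square *)

(** Cutting along the sides of the inner rectangle leaves four outer pieces that avoid [w], and
    Goursat's theorem makes each of them vanish. *)
Lemma rect_int_excise (q : C -> C) (w : C) (x1 x2 y1 y2 a b c d : R) :
  x1 <= a -> a < fst w < b -> b <= x2 -> y1 <= c -> c < snd w < d -> d <= y2 ->
  (forall z, box x1 x2 y1 y2 z -> z <> w -> ex_cderiv q z) ->
  rect_int q x1 x2 y1 y2 = rect_int q a b c d.
Proof.
  intros H1 H2 H3 H4 H5 H6 Hq.
  assert (Hx : forall s t, box x1 x2 y1 y2 (s, t) -> s <> fst w -> ex_cderiv q (s, t)).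
  { intros s t Hb Hs. apply Hq; [exact Hb|]. intros E; apply Hs; rewrite <- E; reflexivity. }
  assert (Hy : forall s t, box x1 x2 y1 y2 (s, t) -> t <> snd w -> ex_cderiv q (s, t)).
  { intros s t Hb Hs. apply Hq; [exact Hb|]. intros E; apply Hs; rewrite <- E; reflexivity. }
  rewrite (rect_int_split_x q x1 a x2), (rect_int_split_x q a b x2),
    (rect_int_split_y q a b y1 c y2), (rect_int_split_y q a b c d y2);
    try lra;
    try (intros t Ht; split; first [apply Hx; [unfold box; simpl; lra | lra]
                                   |apply Hy; [unfold box; simpl; lra | lra]]).
  assert (G : forall s1 s2 t1 t2, x1 <= s1 -> s1 <= s2 -> s2 <= x2 -> y1 <= t1 -> t1 <= t2 ->
    t2 <= y2 -> s2 < fst w \/ fst w < s1 \/ t2 < snd w \/ snd w < t1 ->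
    rect_int q s1 s2 t1 t2 = 0%C).
  { intros s1 s2 t1 t2 K1 K2 K3 K4 K5 K6 K7. apply Goursat; auto.
    intros z [Hz1 Hz2]. apply Hq; [unfold box; lra|]. intros ->. lra. }
  rewrite (G x1 a y1 y2), (G b x2 y1 y2), (G a b y1 c), (G a b d y2) by lra. ring.
Qed.

Definition square (a : C) (r : R) : C -> Prop :=
  box (fst a - r) (fst a + r) (snd a - r) (snd a + r).

Definition square_boundary (a : C) (r : R) : C -> Prop :=
  box_boundary (fst a - r) (fst a + r) (snd a - r) (snd a + r).

Definition square_int (a : C) (r : R) (g : C -> C) : C :=
  rect_int g (fst a - r) (fst a + r) (snd a - r) (snd a + r).

Lemma square_Cmod (a z : C) (r : R) : square a r z -> Cmod (z - a) <= 2 * r.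
Proof.
  intros [H1 H2]. eapply Rle_trans; [apply Cmod_le_abs|].
  replace (2 * r) with (r + r) by ring.
  apply Rplus_le_compat; unfold Cminus, Cplus, Copp; simpl; apply Rabs_le; lra.
Qed.

Lemma square_boundary_Cmod (a z : C) (r : R) : 0 < r -> square_boundary a r z -> r <= Cmod (z - a).
Proof.
  intros r0 [_ H].
  assert (H1 := Cmod_fst_minus z a). assert (H2 := Cmod_snd_minus z a).
  destruct H as [H | [H | [H | H]]]; rewrite H in *; clear H;
    [eapply Rle_trans; [|exact H1] | eapply Rle_trans; [|exact H1]
    |eapply Rle_trans; [|exact H2] | eapply Rle_trans; [|exact H2]];
    unfold Rabs; destruct Rcase_abs; lra.
Qed.

Lemma square_boundary_far (a z w : C) (r : R) : 0 < r -> square_boundary a r z ->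
  Cmod (w - a) <= r / 2 -> r / 2 <= Cmod (z - w).
Proof.
  intros r0 Hz Hw. assert (H1 := square_boundary_Cmod a z r r0 Hz).
  assert (H2 := Cmod_triangle3 z w a). lra.
Qed.

Lemma ex_cderiv_kernel (w z : C) : z <> w -> ex_cderiv (fun u => / (u - w))%C z.
Proof.
  intros Hz. apply (ex_cderiv_inv (fun u => u - w)%C); auto with cderiv.
  apply Cminus_eq_contra, Hz.
Qed.

Section Square.

Variables (a : C) (r : R).
Hypothesis r0 : 0 < r.

Lemma square_boundary_neq (z w : C) :
  square_boundary a r z -> Cmod (w - a) <= r / 2 -> z <> w.
Proof.
  intros Hz Hw E. assert (H := square_boundary_far a z w r r0 Hz Hw).
  rewrite E in H. replace (w - w)%C with (RtoC 0) in H by ring. rewrite Cmod_0 in H. lra.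
Qed.

Lemma square_int_lin (c : C) (f g : C -> C) :
  (forall z, square_boundary a r z -> ex_cderiv f z) ->
  (forall z, square_boundary a r z -> ex_cderiv g z) ->
  square_int a r (fun z => f z + c * g z)%C = (square_int a r f + c * square_int a r g)%C.
Proof.
  intros Hf Hg. unfold square_int.
  rewrite rect_int_plus, rect_int_scal; auto; try lra.
  intros z Hz. apply ex_cderiv_mult; auto with cderiv.
Qed.

Lemma square_int_ext (f g : C -> C) : (forall z, square_boundary a r z -> f z = g z) ->
  square_int a r f = square_int a r g.
Proof. intros H. unfold square_int. apply rect_int_ext; try lra. exact H. Qed.

Lemma square_int_bound (f : C -> C) (M : R) :
  (forall z, square_boundary a r z -> ex_cderiv f z) ->
  (forall z, square_boundary a r z -> Cmod (f z) <= M) ->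
  Cmod (square_int a r f) <= 8 * r * M.
Proof.
  intros Hf HM. unfold square_int. eapply Rle_trans; [apply rect_int_bound|]; eauto; lra.
Qed.

(** The difference quotient [q] of [f] at [w] is bounded near [w]. Its integral is unchanged when
    the square shrinks to [w], where the length of the contour tends to zero, so it is zero;
    linearity then isolates [f w]. *)
Lemma Cauchy_square (f : C -> C) (w : C) :
  (forall z, square a r z -> ex_cderiv f z) -> Cmod (w - a) <= r / 2 ->
  square_int a r (fun z => f z * / (z - w))%C = (f w * square_int a r (fun z => / (z - w)))%C.
Proof.
  intros Hf Hw.
  assert (Hw1 := Cmod_fst_minus w a). assert (Hw2 := Cmod_snd_minus w a).
  apply Rabs_le_between in Hw1. apply Rabs_le_between in Hw2.
  set (q := fun z => ((f z - f w) * / (z - w))%C).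
  assert (Hq : forall z, square a r z -> z <> w -> ex_cderiv q z).
  { intros z Hz Hzw. unfold q. apply ex_cderiv_mult; [|apply ex_cderiv_kernel, Hzw].
    apply ex_cderiv_minus; auto with cderiv. }
  assert (Hbd : forall z, square_boundary a r z -> square a r z) by (intros z [H _]; exact H).
  assert (Eq : square_int a r q = 0%C).
  { destruct (Hf w) as [l Hl]; [unfold square, box; lra|].
    rewrite is_cderiv_eps in Hl. destruct (Hl 1 Rlt_0_1) as [d [d0 Hd]].
    set (M := Cmod l + 1). assert (HM : 0 < M) by (assert (H := Cmod_ge_0 l); unfold M; lra).
    assert (Hb : forall z, Cmod (z - w) < d -> z <> w -> Cmod (q z) <= M).
    { intros z Hz Hzw. specialize (Hd z Hz).
      assert (Hm : 0 < Cmod (z - w)) by (apply Cmod_gt_0, Cminus_eq_contra, Hzw).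
      unfold q. rewrite Cmod_mult, Cmod_inv by (apply Cminus_eq_contra, Hzw).
      assert (Ht := Cmod_triangle_sub (f z - f w) (l * (z - w))). rewrite Cmod_mult in Ht.
      apply (Rmult_le_reg_r (Cmod (z - w))); [exact Hm|].
      rewrite Rmult_assoc, Rinv_l by lra. unfold M. lra. }
    (* The square of half-side [e] around [w] lies within distance [2 * e] of [w], where [q] is
       bounded, and [e < r / 2] keeps it inside the large square. *)
    assert (Hsmall : forall e, 0 < e -> 2 * e < d -> e < r / 2 ->
      Cmod (square_int a r q) <= 8 * e * M).
    { intros e e0 Hed Her. unfold square_int.
      rewrite (rect_int_excise q w _ _ _ _ (fst w - e) (fst w + e) (snd w - e) (snd w + e));
        try lra; [|exact Hq].
      assert (Hin : forall z, square_boundary w e z -> z <> w).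
      { intros z Hz E. assert (H := square_boundary_Cmod w z e e0 Hz).
        rewrite E in H. replace (w - w)%C with (RtoC 0) in H by ring. rewrite Cmod_0 in H. lra. }
      eapply Rle_trans; [apply (rect_int_bound _ _ _ _) with (M := M)|]; try lra.
      - intros z Hz. apply Hq; [|apply Hin, Hz].
        destruct Hz as [[Hz1 Hz2] _]. unfold square, box; lra.
      - intros z Hz. apply Hb; [|apply Hin, Hz].
        destruct Hz as [Hz _]. assert (H := square_Cmod w z e Hz). lra. }
    apply Cmod_eq_0. apply Rle_antisym; [|apply Cmod_ge_0].
    apply Rnot_lt_le. intros Hpos.
    set (m := Cmod (square_int a r q)) in *.
    (* The last term makes [8 * e * M] at most [m / 2], which contradicts [m <= 8 * e * M]. *)
    set (e := Rmin (Rmin (d / 3) (r / 3)) (m / (16 * M))).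
    assert (He1 : e <= d / 3) by (eapply Rle_trans; [apply Rmin_l | apply Rmin_l]).
    assert (He2 : e <= r / 3) by (eapply Rle_trans; [apply Rmin_l | apply Rmin_r]).
    assert (He3 : e <= m / (16 * M)) by (apply Rmin_r).
    assert (He : 0 < e).
    { repeat apply Rmin_glb_lt; try lra. apply Rdiv_lt_0_compat; lra. }
    specialize (Hsmall e He). 
    assert (m = m / (16 * M) * (16 * M)) by (field; lra).
    assert (m <= 8 * e * M) by (apply Hsmall; lra). nra. }
  rewrite (square_int_ext (fun z => f z * / (z - w))%C (fun z => q z + f w * / (z - w))%C).
  2: { intros z _. unfold q. ring. }
  rewrite square_int_lin.
  - rewrite Eq. ring.
  - intros z Hz. apply Hq; [apply Hbd, Hz | eapply square_boundary_neq; eassumption].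
  - intros z Hz. apply ex_cderiv_kernel. eapply square_boundary_neq; eassumption.
Qed.

Lemma ex_cderiv_kernel_mult (f : C -> C) (w : C) : Cmod (w - a) <= r / 2 ->
  (forall z, square_boundary a r z -> ex_cderiv f z) ->
  forall z, square_boundary a r z -> ex_cderiv (fun u => f u * / (u - w))%C z.
Proof.
  intros Hw Hf z Hz. apply ex_cderiv_mult; [apply Hf, Hz|].
  apply ex_cderiv_kernel. eapply square_boundary_neq; eassumption.
Qed.

(** The boundary stays at distance at least [r / 2] from [w], so each kernel factor costs [2 / r].
    Iteration produces the powers of [2 / r] in the bounds below. *)
Lemma Cmod_kernel_mult (f : C -> C) (w : C) (M : R) : Cmod (w - a) <= r / 2 ->
  (forall z, square_boundary a r z -> Cmod (f z) <= M) ->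
  forall z, square_boundary a r z -> Cmod (f z * / (z - w)) <= M * (2 / r).
Proof.
  intros Hw HM z Hz. rewrite Cmod_mult, Cmod_inv.
  2: { apply Cminus_eq_contra. eapply square_boundary_neq; eassumption. }
  assert (H := square_boundary_far a z w r r0 Hz Hw).
  apply Rmult_le_compat; [apply Cmod_ge_0 | | apply HM, Hz |].
  - left; apply Rinv_0_lt_compat; lra.
  - replace (2 / r) with (/ (r / 2)) by (field; lra). apply Rinv_le_contravar; lra.
Qed.

(* Second-order Taylor expansion of a Cauchy-type integral, from
   1/(z-w) = 1/(z-b) + (w-b)/(z-b)^2 + (w-b)^2/((z-b)^2 (z-w)). *)
Lemma Cauchy_integral_taylor (f : C -> C) (b w : C) (M : R) :
  Cmod (b - a) <= r / 2 -> Cmod (w - a) <= r / 2 ->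
  (forall z, square_boundary a r z -> ex_cderiv f z) ->
  (forall z, square_boundary a r z -> Cmod (f z) <= M) ->
  Cmod (square_int a r (fun z => f z * / (z - w))
        - square_int a r (fun z => f z * / (z - b))
        - (w - b) * square_int a r (fun z => f z * / (z - b) * / (z - b)))%C
  <= 8 * r * (M * (2 / r) * (2 / r) * (2 / r)) * Cmod (w - b) ^ 2.
Proof.
  intros Hb Hw Hf HM.
  assert (D1 := ex_cderiv_kernel_mult f b Hb Hf).
  assert (D2 := ex_cderiv_kernel_mult _ b Hb D1).
  assert (D3 := ex_cderiv_kernel_mult _ w Hw D2).
  assert (D4 : forall z, square_boundary a r z -> ex_cderiv (fun z => f z * / (z - b) +
    (w - b) * (f z * / (z - b) * / (z - b)))%C z).
  { intros z Hz. apply ex_cderiv_plus; [apply D1, Hz|].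
    apply ex_cderiv_mult; [apply ex_cderiv_const | apply D2, Hz]. }
  rewrite (square_int_ext (fun z => f z * / (z - w))%C
    (fun z => (f z * / (z - b) + (w - b) * (f z * / (z - b) * / (z - b)))
       + ((w - b) * (w - b)) * (f z * / (z - b) * / (z - b) * / (z - w)))%C).
  2: { intros z Hz. field. split; apply Cminus_eq_contra; eapply square_boundary_neq; eassumption. }
  rewrite square_int_lin by assumption. rewrite square_int_lin by assumption.
  match goal with |- Cmod ?X <= _ => replace X with ((w - b) * (w - b) *
    square_int a r (fun z => f z * / (z - b) * / (z - b) * / (z - w)))%C by ring end.
  rewrite !Cmod_mult.
  assert (B := square_int_bound _ _ D3
    (Cmod_kernel_mult _ w _ Hw (Cmod_kernel_mult _ b _ Hb (Cmod_kernel_mult f b M Hb HM)))).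
  rewrite Rmult_comm. replace (Cmod (w - b) * Cmod (w - b)) with (Cmod (w - b) ^ 2) by ring.
  apply Rmult_le_compat_r; [apply pow2_ge_0 | exact B].
Qed.

(** This is the number [2 pi i], kept as an integral: Cauchy's formula divides by it and asks only
    that it be nonzero. *)
Definition winding : C := square_int a r (fun z => / (z - a))%C.

(** The integrand has the primitive [- / (z - w)]. The leading factor [1] matches
    [Cauchy_integral_taylor] applied to the constant function 1. *)
Lemma square_int_kernel_sq (w : C) : Cmod (w - a) <= r / 2 ->
  square_int a r (fun z => 1 * / (z - w) * / (z - w))%C = 0%C.
Proof.
  intros Hw. unfold square_int.
  apply (rect_int_primitive (fst a - r) (fst a + r) (snd a - r) (snd a + r) ltac:(lra) ltac:(lra) (fun z => RtoC (-1) * / (z - w))%C).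
  - intros z Hz. assert (Hzw : z <> w) by (eapply square_boundary_neq; eassumption).
    assert (H0 : (z - w)%C <> 0%C) by (apply Cminus_eq_contra, Hzw).
    assert (Hid : is_cderiv (fun u => u - w)%C z (RtoC 1)).
    { apply is_cderiv_eps. intros e e0. exists 1; split; [lra|]. intros u _.
      replace (u - w - (z - w) - 1 * (u - z))%C with (RtoC 0) by ring. rewrite Cmod_0.
      assert (H := Cmod_ge_0 (u - z)). nra. }
    assert (HH := is_cderiv_mult (fun _ => RtoC (-1)) _ z _ _
      (is_derive_const (K := C_AbsRing) (V := C_NormedModule) (RtoC (-1)) z)
      (is_cderiv_comp Cinv (fun u => u - w)%C z _ _ (is_cderiv_inv _ H0) Hid)).
    replace (1 * / (z - w) * / (z - w))%C
      with (RtoC 0 * / (z - w) + RtoC (-1) * (- / ((z - w) * (z - w)) * 1))%C by (field; exact H0).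
    exact HH.
  - intros z Hz. assert (Hzw : z <> w) by (eapply square_boundary_neq; eassumption).
    apply ex_cderiv_mult; [apply ex_cderiv_mult|]; auto using ex_cderiv_kernel with cderiv.
Qed.

(** Move the pole along the segment from [a] to [w]. By [Cauchy_integral_taylor] the derivative of
    the integral is the integral of the squared kernel, up to the factor [w - a], and that is
    zero. *)
Lemma square_int_kernel_const (w : C) : Cmod (w - a) <= r / 4 ->
  square_int a r (fun z => / (z - w))%C = winding.
Proof.
  intros Hw. unfold winding.
  set (N := fun t => square_int a r (fun z => 1 * / (z - (a + RtoC t * (w - a))))%C).
  assert (E : N 0 = N 1).
  { apply (eq_is_derive (V := C_R_NormedModule)); [|lra]. intros t Ht.
    apply is_rderiv_eps. intros e e0.
    set (K := 8 * r * (1 * (2 / r) * (2 / r) * (2 / r)) * Cmod (w - a) ^ 2).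
    assert (HK : 0 <= K).
    { unfold K. apply Rmult_le_pos; [|apply pow2_ge_0].
      assert (Hr : 0 < 2 / r) by (apply Rdiv_lt_0_compat; lra).
      apply Rmult_le_pos; [lra|].
      repeat (apply Rmult_le_pos; [|left; exact Hr]). lra. }
    (* The derivative is two-sided even at the ends of [[0, 1]], so the pole must be allowed
       slightly beyond the segment. The bound [r / 4] on [w - a] gives room for all parameters up to
       2. *)
    assert (Hp : forall s, Rabs s <= 2 -> Cmod (a + RtoC s * (w - a) - a) <= r / 2).
    { intros s Hs. replace (a + RtoC s * (w - a) - a)%C with (RtoC s * (w - a))%C by ring.
      rewrite Cmod_mult, Cmod_R. assert (H0 := Cmod_ge_0 (w - a)).
      assert (H1 := Rabs_pos s). nra. }
    exists (Rmin 1 (e / (1 + K))). split.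
    { apply Rmin_glb_lt; [lra | apply Rdiv_lt_0_compat; lra]. }
    intros s Hs.
    assert (Hs1 : Rabs (s - t) < 1) by (eapply Rlt_le_trans; [exact Hs | apply Rmin_l]).
    assert (Hs2 : Rabs (s - t) < e / (1 + K)) by (eapply Rlt_le_trans; [exact Hs | apply Rmin_r]).
    assert (Ht2 : Rabs t <= 2) by (apply Rabs_le; lra).
    assert (Hs3 : Rabs s <= 2) by (apply Rabs_def2 in Hs1; apply Rabs_le; lra).
    assert (T := Cauchy_integral_taylor (fun _ => 1%C) _ _ 1 (Hp t Ht2) (Hp s Hs3)
      (fun z _ => ex_cderiv_const 1%C z) (fun z _ => Req_le _ _ Cmod_1)).
    cbv beta in T. rewrite (square_int_kernel_sq _ (Hp t Ht2)) in T.
    change (@zero C_R_NormedModule) with (RtoC 0). unfold N.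
    match type of T with Cmod ?X <= _ =>
      match goal with |- Cmod ?Y <= _ => replace Y with X by ring end end.
    eapply Rle_trans; [exact T|].
    replace (a + RtoC s * (w - a) - (a + RtoC t * (w - a)))%C with (RtoC (s - t) * (w - a))%C
      by (rewrite RtoC_minus; ring).
    rewrite Cmod_mult, Cmod_R, Rpow_mult_distr.
    apply (Rmult_lt_compat_r (1 + K)) in Hs2; [|lra].
    unfold Rdiv in Hs2. rewrite Rmult_assoc, Rinv_l, Rmult_1_r in Hs2 by lra.
    replace (8 * r * (1 * (2 / r) * (2 / r) * (2 / r)) * (Rabs (s - t) ^ 2 * Cmod (w - a) ^ 2))
      with (K * Rabs (s - t) * Rabs (s - t)) by (unfold K; ring).
    apply Rmult_le_compat_r; [apply Rabs_pos|]. assert (H := Rabs_pos (s - t)). nra. }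
  transitivity (N 1); [|rewrite <- E]; unfold N; apply square_int_ext; intros z _.
  - replace (a + 1 * (w - a))%C with w by ring. ring.
  - replace (a + 0 * (w - a))%C with a by ring. ring.
Qed.

(** On every edge the integrand has imaginary part [r / (r * r + t * t)], where [t] is the offset
    from the midpoint. This is at least [/ (2 * r)] on an edge of length [2 * r], so each edge
    contributes at least 1 and the imaginary part is at least 4. *)
Lemma winding_neq_0 : winding <> 0%C.
Proof.
  set (k := fun z => (/ (z - a))%C).
  assert (H0 : Cmod (a - a) <= r / 2).
  { replace (a - a)%C with (RtoC 0) by ring. rewrite Cmod_0. lra. }
  destruct (ex_CInt_edges (fst a - r) (fst a + r) (snd a - r) (snd a + r) ltac:(lra) ltac:(lra) k)
    as [Ia [Ib [Ic Id]]].
  { intros z Hz. apply ex_cderiv_kernel. apply (square_boundary_neq z a Hz H0). }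
  assert (Hq : forall t, - r <= t <= r -> / (2 * r) <= r / (r * r + t * t)).
  { intros t Ht. assert (t * t <= r * r) by nra.
    assert (0 < r * r) by nra. assert (H2 := Rle_0_sqr t). unfold Rsqr in H2.
    apply (Rmult_le_reg_r (2 * r * (r * r + t * t))); [nra|].
    replace (/ (2 * r) * (2 * r * (r * r + t * t))) with (r * r + t * t) by (field; lra).
    replace (r / (r * r + t * t) * (2 * r * (r * r + t * t))) with (2 * (r * r)) by (field; lra).
    lra. }
  (* The factor [c] is the direction of travel along the edge: 1, [i], -1 and [- i] for bottom,
     right, top and left. *)
  assert (Hedge : forall (c : C) (e : R -> C) (s : R),
    ex_CInt (fun x => k (e x)) (s - r) (s + r) ->
    (forall x, snd (c * k (e x))%C = r / (r * r + (x - s) * (x - s))) ->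
    1 <= snd (c * CInt (fun x => k (e x)) (s - r) (s + r))%C).
  { intros c e s Hi He.
    replace 1 with ((s + r - (s - r)) * / (2 * r)) by (field; lra).
    apply (is_CInt_snd_ge (fun x => c * k (e x))%C); [lra | |].
    - intros x Hx. rewrite He. apply Hq. lra.
    - apply is_CInt_scal, CInt_correct, Hi. }
  assert (Ba := Hedge (RtoC 1) _ _ Ia). assert (Bb := Hedge Ci _ _ Ib).
  assert (Bc := Hedge (RtoC (-1)) _ _ Ic). assert (Bd := Hedge (- Ci)%C _ _ Id).
  assert (Hs : forall x, 0 < r * r + x * x)
    by (intros x; assert (H2 := Rle_0_sqr x); unfold Rsqr in H2; nra).
  intros E. apply (f_equal snd) in E.
  assert (4 <= snd winding).
  { unfold winding, square_int, rect_int. fold k.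
    match goal with |- _ <= snd (?A + Ci * ?B - ?D - Ci * ?E)%C =>
      replace (A + Ci * B - D - Ci * E)%C with (1 * A + Ci * B + (-1) * D + (- Ci) * E)%C by ring
    end.
    replace 4 with (1 + 1 + 1 + 1) by ring.
    repeat apply Rplus_le_compat; [apply Ba | apply Bb | apply Bc | apply Bd];
      intros x; specialize (Hs (x - fst a)) as Hs1; specialize (Hs (x - snd a)) as Hs2;
      unfold k, Cinv, Cmult, Cminus, Cplus, Copp, Ci, RtoC; simpl; field; repeat split; nra. }
  change (snd winding = 0) in E. lra.
Qed.

End Square.

(** * Taylor bounds and holomorphy of the derivative *)

Lemma is_cderiv_quadratic (f : C -> C) (z l : C) (d K : R) : 0 < d ->
  (forall w, Cmod (w - z) < d -> Cmod (f w - f z - l * (w - z)) <= K * Cmod (w - z) ^ 2) ->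
  is_cderiv f z l.
Proof.
  intros d0 HK. apply is_cderiv_eps. intros eps e0.
  assert (HK0 := Rabs_pos K). assert (HK1 := Rle_abs K).
  exists (Rmin d (eps / (1 + Rabs K))). split.
  { apply Rmin_glb_lt; [exact d0 | apply Rdiv_lt_0_compat; lra]. }
  intros w Hw.
  assert (Hw1 : Cmod (w - z) < d) by (eapply Rlt_le_trans; [exact Hw | apply Rmin_l]).
  assert (Hw2 : Cmod (w - z) < eps / (1 + Rabs K))
    by (eapply Rlt_le_trans; [exact Hw | apply Rmin_r]).
  eapply Rle_trans; [apply HK, Hw1|].
  apply (Rmult_lt_compat_r (1 + Rabs K)) in Hw2; [|lra].
  unfold Rdiv in Hw2. rewrite Rmult_assoc, Rinv_l, Rmult_1_r in Hw2 by lra.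
  assert (H0 := Cmod_ge_0 (w - z)).
  replace (K * Cmod (w - z) ^ 2) with (K * Cmod (w - z) * Cmod (w - z)) by ring.
  apply Rmult_le_compat_r; [exact H0|]. nra.
Qed.

Section CauchyTaylor.

Variables (a : C) (r M : R) (f : C -> C).
Hypothesis r0 : 0 < r.
Hypothesis Hf : forall z, square a r z -> ex_cderiv f z.
Hypothesis HM : forall z, square_boundary a r z -> Cmod (f z) <= M.

Let W := winding a r.

(** Cauchy's integral for the derivative of [f], with [W] for [2 pi i]. The point [b] enters only
    through the kernel, which can be expanded once more. *)
Definition cauchy_deriv (b : C) : C :=
  (/ W * square_int a r (fun z => f z * / (z - b) * / (z - b)))%C.

Lemma boundary_ex_cderiv (z : C) : square_boundary a r z -> ex_cderiv f z.
Proof. intros [Hz _]. apply Hf, Hz. Qed.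

Lemma Cauchy_formula (w : C) : Cmod (w - a) <= r / 4 ->
  f w = (/ W * square_int a r (fun z => f z * / (z - w)))%C.
Proof.
  intros Hw. rewrite Cauchy_square; auto; [|lra].
  rewrite square_int_kernel_const; auto. fold W.
  field. exact (winding_neq_0 a r r0).
Qed.

(** The constant depends on [f] only through [M], which later makes the expansion uniform over a
    family. *)
Lemma Cauchy_taylor (b w : C) : Cmod (b - a) <= r / 4 -> Cmod (w - a) <= r / 4 ->
  Cmod (f w - f b - cauchy_deriv b * (w - b))
  <= / Cmod W * (8 * r * (M * (2 / r) * (2 / r) * (2 / r))) * Cmod (w - b) ^ 2.
Proof.
  intros Hb Hw. rewrite (Cauchy_formula w Hw), (Cauchy_formula b Hb). unfold cauchy_deriv.
  match goal with |- Cmod (/ W * ?A - / W * ?B - / W * ?D * ?E)%C <= _ =>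
    replace (/ W * A - / W * B - / W * D * E)%C with (/ W * (A - B - E * D))%C by ring end.
  assert (HW : W <> 0%C) by exact (winding_neq_0 a r r0).
  rewrite Cmod_mult, Cmod_inv by exact HW. rewrite Rmult_assoc.
  apply Rmult_le_compat_l; [left; apply Rinv_0_lt_compat, Cmod_gt_0, HW|].
  apply Cauchy_integral_taylor; auto; try lra. apply boundary_ex_cderiv.
Qed.

Lemma is_cderiv_cauchy (b : C) : Cmod (b - a) <= r / 8 -> is_cderiv f b (cauchy_deriv b).
Proof.
  intros Hb.
  apply (is_cderiv_quadratic f b _ (r / 8)
    (/ Cmod W * (8 * r * (M * (2 / r) * (2 / r) * (2 / r))))); [lra|].
  intros w Hw. apply Cauchy_taylor; [lra|].
  assert (H := Cmod_triangle3 w b a). lra.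
Qed.

(** With [u = z - a], [v = z - b] and [k = b - a], one has [1/v^2 = 1/u^2 + 2k/u^3 + k^2 (1/(u^2
    v^2) + 2/(u^3 v))]. Integrated against [f], the middle term gives the derivative and the last
    one a quadratic error; the 3 in its bound counts [1 + 2]. Differentiability at the centre is
    enough, as squares can be centred anywhere. *)
Lemma ex_cderiv_cauchy_deriv : ex_cderiv cauchy_deriv a.
Proof.
  assert (Ha : Cmod (a - a) <= r / 2).
  { replace (a - a)%C with (RtoC 0) by ring. rewrite Cmod_0. lra. }
  assert (HW : W <> 0%C) by exact (winding_neq_0 a r r0).
  assert (A1 := ex_cderiv_kernel_mult a r r0 f a Ha boundary_ex_cderiv).
  assert (A2 := ex_cderiv_kernel_mult a r r0 _ a Ha A1).
  assert (A3 := ex_cderiv_kernel_mult a r r0 _ a Ha A2).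
  assert (B2 := Cmod_kernel_mult a r r0 _ a _ Ha (Cmod_kernel_mult a r r0 f a M Ha HM)).
  assert (B3 := Cmod_kernel_mult a r r0 _ a _ Ha B2).
  exists (/ W * (2 * square_int a r (fun z => f z * / (z - a) * / (z - a) * / (z - a))))%C.
  apply (is_cderiv_quadratic _ a _ (r / 8)
    (/ Cmod W * (8 * r * (3 * (M * (2 / r) * (2 / r) * (2 / r) * (2 / r)))))); [lra|].
  intros b Hb. assert (Hb2 : Cmod (b - a) <= r / 2) by lra.
  assert (D3 := ex_cderiv_kernel_mult a r r0 _ b Hb2 A2).
  assert (D4 := ex_cderiv_kernel_mult a r r0 _ b Hb2 D3).
  assert (D5 := ex_cderiv_kernel_mult a r r0 _ b Hb2 A3).
  assert (N4 := Cmod_kernel_mult a r r0 _ b _ Hb2 (Cmod_kernel_mult a r r0 _ b _ Hb2 B2)).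
  assert (N5 := Cmod_kernel_mult a r r0 _ b _ Hb2 B3).
  cbv beta in *.
  set (rem := fun z => (f z * / (z - a) * / (z - a) * / (z - b) * / (z - b)
    + 2 * (f z * / (z - a) * / (z - a) * / (z - a) * / (z - b)))%C).
  assert (Hrem : forall z, square_boundary a r z -> ex_cderiv rem z).
  { intros z Hz. unfold rem. apply ex_cderiv_plus; [apply D4, Hz|].
    apply ex_cderiv_mult; [apply ex_cderiv_const | apply D5, Hz]. }
  unfold cauchy_deriv.
  rewrite (square_int_ext a r r0 (fun z => f z * / (z - b) * / (z - b))%C
    (fun z => (f z * / (z - a) * / (z - a)
      + (2 * (b - a)) * (f z * / (z - a) * / (z - a) * / (z - a)))
      + ((b - a) * (b - a)) * rem z)%C).
  2: { intros z Hz. unfold rem. field.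
       split; apply Cminus_eq_contra; eapply square_boundary_neq; eassumption. }
  rewrite square_int_lin; auto.
  2: { intros z Hz. apply ex_cderiv_plus; [apply A2, Hz|].
       apply ex_cderiv_mult; [apply ex_cderiv_const | apply A3, Hz]. }
  rewrite square_int_lin by assumption.
  match goal with |- Cmod ?X <= _ => replace X with
    (/ W * (square_int a r rem * ((b - a) * (b - a))))%C by ring end.
  rewrite !Cmod_mult, Cmod_inv, Rmult_assoc by exact HW.
  apply Rmult_le_compat_l; [left; apply Rinv_0_lt_compat, Cmod_gt_0, HW|].
  replace (Cmod (b - a) * Cmod (b - a)) with (Cmod (b - a) ^ 2) by ring.
  apply Rmult_le_compat_r; [apply pow2_ge_0|].
  apply square_int_bound; auto. intros z Hz. unfold rem.
  eapply Rle_trans; [apply Cmod_triangle|]. rewrite (Cmod_mult 2).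
  rewrite Cmod_R, Rabs_right by lra.
  specialize (N4 z Hz). specialize (N5 z Hz). lra.
Qed.

End CauchyTaylor.

Lemma square_in_ball (a z : C) (r d : R) : 2 * r < d -> square a r z -> Cmod (z - a) < d.
Proof. intros Hr Hz. assert (H := square_Cmod a z r Hz). lra. Qed.

(** [K] and [e] are fixed before [f], so that one expansion covers every member of a bounded
    family. *)
Lemma taylor_uniform (a : C) (d M : R) : 0 < d -> 0 <= M ->
  exists K e, 0 <= K /\ 0 < e /\ forall f : C -> C,
    (forall z, Cmod (z - a) < d -> ex_cderiv f z) ->
    (forall z, Cmod (z - a) < d -> Cmod (f z) <= M) ->
    exists l, is_cderiv f a l /\
      forall w, Cmod (w - a) < e -> Cmod (f w - f a - l * (w - a)) <= K * Cmod (w - a) ^ 2.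
Proof.
  intros d0 M0. set (r := d / 4). assert (r0 : 0 < r) by (unfold r; lra).
  assert (HW := proj1 (Cmod_gt_0 _) (winding_neq_0 a r r0)).
  exists (/ Cmod (winding a r) * (8 * r * (M * (2 / r) * (2 / r) * (2 / r)))), (r / 4).
  split; [|split; [lra|]].
  { assert (Hr : 0 <= 2 / r) by (left; apply Rdiv_lt_0_compat; lra).
    apply Rmult_le_pos; [left; apply Rinv_0_lt_compat, HW|].
    apply Rmult_le_pos; [lra|]. repeat (apply Rmult_le_pos; [|exact Hr]). exact M0. }
  intros f Hf HM.
  assert (Hf' : forall z, square a r z -> ex_cderiv f z)
    by (intros z Hz; apply Hf; apply (square_in_ball a z r); [unfold r; lra | exact Hz]).
  assert (HM' : forall z, square_boundary a r z -> Cmod (f z) <= M)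
    by (intros z [Hz _]; apply HM; apply (square_in_ball a z r); [unfold r; lra | exact Hz]).
  assert (Ha : Cmod (a - a) <= 0).
  { replace (a - a)%C with (RtoC 0) by ring. rewrite Cmod_0. lra. }
  exists (cauchy_deriv a r f a). split.
  - apply (is_cderiv_cauchy a r M f); auto. lra.
  - intros w Hw. apply Cauchy_taylor; auto; lra.
Qed.

(** Near [a] the derivative coincides with [cauchy_deriv]. The required bound on [f] over the square
    comes from continuity at the single point [a], by taking the square small, so compactness is
    avoided. *)
Lemma ex_cderiv_C_derive (f : C -> C) (a : C) (d : R) : 0 < d ->
  (forall z, Cmod (z - a) < d -> ex_cderiv f z) -> ex_cderiv (C_derive f) a.
Proof.
  intros d0 Hf.
  assert (Haa : Cmod (a - a) = 0).
  { replace (a - a)%C with (RtoC 0) by ring. apply Cmod_0. }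
  destruct (ex_cderiv_cont f a (Hf a ltac:(lra)) 1 Rlt_0_1) as [e [e0 He]].
  set (r := Rmin d e / 4).
  assert (Hm : 0 < Rmin d e) by (apply Rmin_glb_lt; assumption).
  assert (Hm1 := Rmin_l d e). assert (Hm2 := Rmin_r d e).
  assert (r0 : 0 < r) by (unfold r; lra).
  assert (Hf' : forall z, square a r z -> ex_cderiv f z)
    by (intros z Hz; apply Hf; apply (square_in_ball a z r); [unfold r; lra | exact Hz]).
  assert (HM' : forall z, square_boundary a r z -> Cmod (f z) <= 1 + Cmod (f a)).
  { intros z [Hz _]. assert (Hza : Cmod (z - a) < e)
      by (apply (square_in_ball a z r); [unfold r; lra | exact Hz]).
    specialize (He z Hza). assert (H := Cmod_triangle_sub (f z) (f a)). lra. }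
  apply (ex_cderiv_ext_loc (cauchy_deriv a r f) (C_derive f) a (r / 8)); [lra| |].
  - intros w Hw. symmetry. apply is_C_derive_unique.
    apply (is_cderiv_cauchy a r (1 + Cmod (f a)) f); auto. lra.
  - apply (ex_cderiv_cauchy_deriv a r (1 + Cmod (f a)) f); auto.
Qed.

(** * Time averages of a holomorphic family *)

Definition family_continuous (U : C -> Prop) (J : R -> C -> C) : Prop :=
  forall t z, U z -> forall eps, 0 < eps -> exists d, 0 < d /\
    forall s w, Rabs (s - t) < d -> Cmod (w - z) < d -> U w -> Cmod (J s w - J t z) < eps.

Definition time_int (J : R -> C -> C) (h : R) (z : C) : C := CInt (fun s => J s z) 0 h.

Section Family.

Variables (U : C -> Prop) (J : R -> C -> C).
Hypothesis HJc : family_continuous U J.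
Hypothesis HJ : forall t z, U z -> ex_cderiv (J t) z.

Lemma family_continuous_time (z : C) (t : R) : U z ->
  continuous (U := C_UniformSpace) (fun s => J s z) t.
Proof.
  intros Hz. apply continuous_RC_eps. intros eps e0.
  destruct (HJc t z Hz eps e0) as [d [d0 Hd]]. exists d; split; [exact d0|].
  intros s Hs. apply Hd; auto. rewrite Cmod_minus_diag. exact d0.
Qed.

Lemma ex_CInt_family (z : C) (a b : R) : a <= b -> U z -> ex_CInt (fun s => J s z) a b.
Proof. intros Hab Hz. apply ex_CInt_cont; auto. intros; apply family_continuous_time, Hz. Qed.

Section LocallyBounded.

Variables (b : C) (d h0 M : R).
Hypothesis d0 : 0 < d.
Hypothesis HU : forall z, Cmod (z - b) < d -> U z.
Hypothesis HM : forall s z, Rabs s < h0 -> Cmod (z - b) < d -> Cmod (J s z) <= M.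

Lemma family_taylor : 0 < h0 -> exists K e, 0 <= K /\ 0 < e /\ e <= d /\
  forall s, Rabs s < h0 -> is_cderiv (J s) b (C_derive (J s) b) /\
    forall w, Cmod (w - b) < e ->
      Cmod (J s w - J s b - C_derive (J s) b * (w - b)) <= K * Cmod (w - b) ^ 2.
Proof.
  intros Hh.
  assert (M0 : 0 <= M).
  { apply Rle_trans with (Cmod (J 0 b)); [apply Cmod_ge_0|].
    apply HM; [rewrite Rabs_R0; exact Hh | rewrite Cmod_minus_diag; exact d0]. }
  destruct (taylor_uniform b d M d0 M0) as [K [e [K0 [e0 HK]]]].
  exists K, (Rmin e d).
  split; [exact K0|]. split; [apply Rmin_glb_lt; assumption|]. split; [apply Rmin_r|].
  intros s Hs. split.
  - destruct (HK (J s)) as [l [Hl _]]; auto.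
    rewrite (is_C_derive_unique _ _ _ Hl). exact Hl.
  - intros w Hw. destruct (HK (J s)) as [l [Hl HT]]; auto.
    rewrite (is_C_derive_unique _ _ _ Hl). apply HT.
    eapply Rlt_le_trans; [exact Hw | apply Rmin_l].
Qed.

(** By the uniform Taylor bound, the derivative differs from the difference quotient with a fixed
    small step [x] by at most [K * x], for all small times at once; that quotient is continuous in
    time. *)
Lemma family_deriv_continuous (t : R) : Rabs t < h0 ->
  continuous (U := C_UniformSpace) (fun s => C_derive (J s) b) t.
Proof.
  intros Ht. assert (Hh : 0 < h0) by (assert (H := Rabs_pos t); lra).
  destruct (family_taylor Hh) as [K [e [K0 [e0 [Hed HK]]]]].
  apply continuous_RC_eps. intros eps p0.
  (* This makes each Taylor remainder at most [eps * x / 8]. The two time increments of [J] are kept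
     below [eps * x / 4] each, so the total stays below [eps * x]. *)
  set (x := Rmin (e / 2) (eps / (8 * (K + 1)))).
  assert (x0 : 0 < x) by (apply Rmin_glb_lt; [lra | apply Rdiv_lt_0_compat; lra]).
  assert (Hx1 : x <= e / 2) by apply Rmin_l.
  assert (Hx2 : x * (8 * (K + 1)) <= eps).
  { replace eps with (eps / (8 * (K + 1)) * (8 * (K + 1))) by (field; lra).
    apply Rmult_le_compat_r; [lra | apply Rmin_r]. }
  set (w := (b + RtoC x)%C).
  assert (Ew : (w - b)%C = RtoC x) by (unfold w; ring).
  assert (Mw : Cmod (w - b) = x) by (rewrite Ew, Cmod_R, Rabs_right; lra).
  assert (Hw : U w) by (apply HU; rewrite Mw; lra).
  assert (Hb : U b) by (apply HU; rewrite Cmod_minus_diag; lra).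
  assert (ex0 : 0 < eps * x / 4) by (apply Rdiv_lt_0_compat; [apply Rmult_lt_0_compat|]; lra).
  destruct (HJc t w Hw _ ex0) as [d1 [d10 Hd1]].
  destruct (HJc t b Hb _ ex0) as [d2 [d20 Hd2]].
  exists (Rmin (h0 - Rabs t) (Rmin d1 d2)). split.
  { repeat apply Rmin_glb_lt; lra. }
  intros s Hs.
  assert (Hs1 : Rabs (s - t) < h0 - Rabs t)
    by (eapply Rlt_le_trans; [exact Hs | apply Rmin_l]).
  assert (Hs2 : Rabs (s - t) < d1)
    by (eapply Rlt_le_trans; [exact Hs | eapply Rle_trans; [apply Rmin_r | apply Rmin_l]]).
  assert (Hs3 : Rabs (s - t) < d2)
    by (eapply Rlt_le_trans; [exact Hs | eapply Rle_trans; [apply Rmin_r | apply Rmin_r]]).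
  assert (Hs4 : Rabs s < h0).
  { replace s with ((s - t) + t) by ring. eapply Rle_lt_trans; [apply Rabs_triang|]. lra. }
  assert (T1 := proj2 (HK s Hs4) w). assert (T2 := proj2 (HK t Ht) w).
  assert (C1 : Cmod (J s w - J t w) < eps * x / 4)
    by (apply Hd1; auto; rewrite Cmod_minus_diag; lra).
  assert (C2 : Cmod (J s b - J t b) < eps * x / 4)
    by (apply Hd2; auto; rewrite Cmod_minus_diag; lra).
  rewrite Mw in T1, T2.
  assert (T1' := T1 ltac:(lra)). assert (T2' := T2 ltac:(lra)). clear T1 T2.
  set (Ds := C_derive (J s) b) in *. set (Dt := C_derive (J t) b) in *.
  set (r1 := (J s w - J s b - Ds * (w - b))%C) in *.
  set (r2 := (J t w - J t b - Dt * (w - b))%C) in *.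
  assert (E : ((Ds - Dt) * RtoC x = (J s w - J t w) - (J s b - J t b) - (r1 - r2))%C).
  { unfold r1, r2. rewrite <- Ew. ring. }
  assert (Hb1 : Cmod ((Ds - Dt) * RtoC x) < eps * x).
  { rewrite E. eapply Rle_lt_trans; [apply Cmod_minus_le|].
    assert (B1 := Cmod_minus_le (J s w - J t w) (J s b - J t b)).
    assert (B2 := Cmod_minus_le r1 r2).
    assert (K * x ^ 2 <= eps * x / 8) by nra. lra. }
  rewrite Cmod_mult, Cmod_R, (Rabs_right x) in Hb1 by lra.
  apply (Rmult_lt_reg_r x); assumption.
Qed.

(** Differentiation under the integral: the Taylor bound, uniform in [s], is integrated over
    [[0, h]] and remains quadratic with constant [h * K]. *)
Lemma is_cderiv_time_int (h : R) : 0 < h < h0 ->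
  is_cderiv (time_int J h) b (CInt (fun s => C_derive (J s) b) 0 h).
Proof.
  intros Hh. destruct (family_taylor ltac:(lra)) as [K [e [K0 [e0 [Hed HK]]]]].
  apply (is_cderiv_quadratic _ b _ e (h * K)); [exact e0|].
  intros w Hw. unfold time_int.
  assert (Hb : U b) by (apply HU; rewrite Cmod_minus_diag; lra).
  assert (HUw : U w) by (apply HU; lra).
  assert (ED : ex_CInt (fun s => C_derive (J s) b) 0 h).
  { apply ex_CInt_cont; [lra|]. intros s Hs. apply family_deriv_continuous.
    rewrite Rabs_right; lra. }
  assert (I1 := CInt_correct _ _ _ (ex_CInt_family w 0 h ltac:(lra) HUw)).
  assert (I2 := is_CInt_scal (RtoC (-1)) _ _ _ _
    (CInt_correct _ _ _ (ex_CInt_family b 0 h ltac:(lra) Hb))).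
  assert (I3 := is_CInt_scal (- (w - b))%C _ _ _ _ (CInt_correct _ _ _ ED)).
  assert (I := is_CInt_plus _ _ _ _ _ _ (is_CInt_plus _ _ _ _ _ _ I1 I2) I3).
  match type of I with is_RInt _ _ _ ?l => match goal with |- Cmod ?X <= _ =>
    replace X with l by ring end end.
  replace (h * K * Cmod (w - b) ^ 2) with ((h - 0) * (K * Cmod (w - b) ^ 2)) by ring.
  apply (is_CInt_norm _ 0 h _ _ ltac:(lra)) with (2 := I).
  intros s Hs. cbv beta.
  replace (J s w + RtoC (-1) * J s b + - (w - b) * C_derive (J s) b)%C
    with (J s w - J s b - C_derive (J s) b * (w - b))%C by ring.
  apply HK; [rewrite Rabs_right; lra | exact Hw].
Qed.

End LocallyBounded.

Hypothesis HUo : forall z, U z -> exists d, 0 < d /\ forall w, Cmod (w - z) < d -> U w.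

Lemma family_locally_bounded (a : C) : U a -> exists d, 0 < d /\
  (forall z, Cmod (z - a) < d -> U z) /\
  forall s z, Rabs s < d -> Cmod (z - a) < d -> Cmod (J s z) <= 1 + Cmod (J 0 a).
Proof.
  intros Ha. destruct (HUo a Ha) as [d1 [d10 Hd1]].
  destruct (HJc 0 a Ha 1 Rlt_0_1) as [d2 [d20 Hd2]].
  assert (Hm1 := Rmin_l d1 d2). assert (Hm2 := Rmin_r d1 d2).
  exists (Rmin d1 d2). split; [apply Rmin_glb_lt; assumption|]. split.
  - intros z Hz. apply Hd1. lra.
  - intros s z Hs Hz. specialize (Hd2 s z). rewrite Rminus_0_r in Hd2.
    assert (H := Hd2 ltac:(lra) ltac:(lra) (Hd1 z ltac:(lra))).
    assert (Ht := Cmod_triangle_sub (J s z) (J 0 a)). lra.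
Qed.

(** The same threshold on [h] serves a whole disc around [a]: for one fixed [h] the average must be
    holomorphic near [a] before its derivative can be differentiated at [a]. *)
Lemma ex_cderiv_time_int (a : C) : U a -> exists d, 0 < d /\
  forall h z, 0 < h < d -> Cmod (z - a) < d -> ex_cderiv (time_int J h) z.
Proof.
  intros Ha. destruct (family_locally_bounded a Ha) as [d [d0 [HdU HdM]]].
  (* Halving leaves, around each [z], a disc of radius [d / 2] on which membership in [U] and the
     bound remain available. *)
  exists (d / 2). split; [lra|]. intros h z Hh Hz.
  exists (CInt (fun s => C_derive (J s) z) 0 h).
  assert (Hin : forall w, Cmod (w - z) < d / 2 -> Cmod (w - a) < d)
    by (intros w Hw; assert (H := Cmod_triangle3 w z a); lra).
  apply (is_cderiv_time_int z (d / 2) d (1 + Cmod (J 0 a))); try lra.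
  - intros w Hw. apply HdU, Hin, Hw.
  - intros s w Hs Hw. apply HdM; [exact Hs | apply Hin, Hw].
Qed.

(** At time 0 the space derivative is 1, so by continuity in time it stays within [1 / 2] of 1 for
    small times. Its integral over [[0, h]] is then within [h / 2] of [h], hence not zero. *)
Lemma time_int_deriv_neq_0 (a : C) : U a -> (forall z, U z -> J 0 z = z) -> exists d, 0 < d /\
  forall h, 0 < h < d -> C_derive (time_int J h) a <> 0%C.
Proof.
  intros Ha Hid. destruct (family_locally_bounded a Ha) as [d [d0 [HdU HdM]]].
  assert (H0d : Rabs 0 < d) by (rewrite Rabs_R0; lra).
  assert (Hc := family_deriv_continuous a d d (1 + Cmod (J 0 a)) d0 HdU HdM 0 H0d).
  rewrite continuous_RC_eps in Hc. destruct (Hc (1 / 2)) as [e [e0 He]]; [lra|].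
  assert (E1 : C_derive (J 0) a = 1%C).
  { apply is_C_derive_unique. apply is_cderiv_eps. intros eps p0.
    exists d; split; [exact d0|]. intros w Hw.
    rewrite (Hid w), (Hid a) by auto. replace (w - a - 1 * (w - a))%C with (RtoC 0) by ring.
    rewrite Cmod_0. assert (H := Cmod_ge_0 (w - a)). nra. }
  assert (Hm1 := Rmin_l d e). assert (Hm2 := Rmin_r d e).
  exists (Rmin d e). split; [apply Rmin_glb_lt; assumption|]. intros h Hh.
  rewrite (is_C_derive_unique _ _ _
    (is_cderiv_time_int a d d (1 + Cmod (J 0 a)) d0 HdU HdM h ltac:(lra))).
  assert (ED : ex_CInt (fun s => C_derive (J s) a) 0 h).
  { apply ex_CInt_cont; [lra|]. intros s Hs.
    apply (family_deriv_continuous a d d (1 + Cmod (J 0 a))); auto. rewrite Rabs_right; lra. }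
  assert (I1 : is_CInt (fun _ => RtoC 1) 0 h (RtoC h)).
  { assert (I := is_RInt_const (V := C_R_NormedModule) 0 h (RtoC 1)).
    change (scal (h - 0) (RtoC 1)) with (@scal R_Ring C_R_ModuleSpace (h - 0) (RtoC 1)) in I.
    rewrite scal_R_Cmult, Rminus_0_r, Cmult_1_r in I. exact I. }
  assert (I := is_CInt_plus _ _ _ _ _ _ (CInt_correct _ _ _ ED)
    (is_CInt_scal (RtoC (-1)) _ _ _ _ I1)).
  intros E.
  assert (B' : Cmod (0 + RtoC (-1) * RtoC h) <= (h - 0) * (1 / 2)).
  { rewrite <- E. apply (is_CInt_norm _ 0 h (1 / 2) _ ltac:(lra)) with (2 := I). intros s Hs.
    rewrite <- E1. replace (C_derive (J s) a + RtoC (-1) * C_derive (J 0) a)%C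
      with (C_derive (J s) a - C_derive (J 0) a)%C by ring.
    left. apply He. rewrite Rminus_0_r, Rabs_right; lra. }
  replace (0 + RtoC (-1) * RtoC h)%C with (- RtoC h)%C in B' by ring.
  rewrite Cmod_opp, Cmod_R, Rabs_right in B' by lra. lra.
Qed.

End Family.

(** * One-sided time derivatives *)

(** A division-free form, convenient for adding and composing remainders; it is turned into
    [has_tderiv] only at the end. *)
Definition is_tderiv (g : R -> C) (t : R) (l : C) : Prop :=
  forall eps, 0 < eps -> exists d, 0 < d /\ forall s, 0 <= s -> Rabs (s - t) < d ->
    Cmod (g s - g t - RtoC (s - t) * l) <= eps * Rabs (s - t).

Lemma is_tderiv_has_tderiv (g : R -> C) (t : R) (l : C) : is_tderiv g t l -> has_tderiv g t l.
Proof.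
  intros Hg P HP. apply locally_C_Cmod in HP. destruct HP as [e [e0 He]].
  destruct (Hg (e / 2)) as [d [d0 Hd]]; [lra|].
  exists (mkposreal d d0). intros h Hh [Hh0 Hth]. change R in h. apply He.
  assert (Hh' : Rabs h < d).
  { rewrite <- (Rminus_0_r h). exact Hh. }
  specialize (Hd (t + h) Hth). replace (t + h - t) with h in Hd by ring. specialize (Hd Hh').
  change (@scal R_Ring (prod_ModuleSpace R_Ring R_ModuleSpace R_ModuleSpace) (/ h)
    (minus (g (t + h)) (g t))) with
    (@scal R_Ring C_R_ModuleSpace (/ h) (Cminus (g (t + h)) (g t))).
  rewrite scal_R_Cmult.
  assert (Hc : RtoC h <> 0%C) by (intros E; apply Hh0; exact (f_equal fst E)).
  replace (RtoC (/ h) * (g (t + h)%R - g t) - l)%C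
    with (/ RtoC h * (g (t + h)%R - g t - RtoC h * l))%C
    by (rewrite RtoC_inv by exact Hh0; field; exact Hc).
  rewrite Cmod_mult, Cmod_inv, Cmod_R by exact Hc.
  assert (Hp : 0 < Rabs h) by (apply Rabs_pos_lt, Hh0).
  apply (Rmult_lt_reg_l (Rabs h)); [exact Hp|].
  rewrite <- Rmult_assoc, Rinv_r, Rmult_1_l by lra. nra.
Qed.

(** Only a forward step [t + h] is tested, so the argument covers [t = 0], the case that identifies
    the local generators with each other. *)
Lemma is_tderiv_unique (g : R -> C) (t : R) (l m : C) : 0 <= t ->
  is_tderiv g t l -> is_tderiv g t m -> l = m.
Proof.
  intros Ht Hl Hm. apply Ceq_minus. apply Cmod_eq_0.
  apply Rle_antisym; [|apply Cmod_ge_0]. apply Rnot_lt_le. intros Hp.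
  set (e := Cmod (l - m)) in *.
  destruct (Hl (e / 4)) as [d1 [d10 Hd1]]; [lra|].
  destruct (Hm (e / 4)) as [d2 [d20 Hd2]]; [lra|].
  set (h := Rmin d1 d2 / 2).
  assert (Hm1 := Rmin_l d1 d2). assert (Hm2 := Rmin_r d1 d2).
  assert (Hm0 : 0 < Rmin d1 d2) by (apply Rmin_glb_lt; assumption).
  assert (h0 : 0 < h) by (unfold h; lra).
  specialize (Hd1 (t + h) ltac:(lra)). specialize (Hd2 (t + h) ltac:(lra)).
  replace (t + h - t) with h in Hd1, Hd2 by ring. rewrite (Rabs_right h) in Hd1, Hd2 by lra.
  specialize (Hd1 ltac:(unfold h; lra)). specialize (Hd2 ltac:(unfold h; lra)).
  assert (B := Cmod_minus_le (g (t + h)%R - g t - RtoC h * m) (g (t + h)%R - g t - RtoC h * l)).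
  replace (g (t + h)%R - g t - RtoC h * m - (g (t + h)%R - g t - RtoC h * l))%C
    with (RtoC h * (l - m))%C in B by ring.
  rewrite Cmod_mult, Cmod_R, (Rabs_right h) in B by lra. fold e in B. nra.
Qed.

Lemma is_rderiv_is_tderiv (f g : R -> C) (t : R) (l : C) : 0 <= t ->
  (forall s, 0 <= s -> f s = g s) -> is_rderiv f t l -> is_tderiv g t l.
Proof.
  intros Ht He Hf. rewrite is_rderiv_eps in Hf. intros eps e0.
  destruct (Hf eps e0) as [d [d0 Hd]]. exists d; split; [exact d0|].
  intros s Hs Hst. rewrite <- !He by assumption. apply Hd, Hst.
Qed.

Lemma is_tderiv_ext (f g : R -> C) (t : R) (l : C) : 0 <= t ->
  (forall s, 0 <= s -> f s = g s) -> is_tderiv f t l -> is_tderiv g t l.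
Proof.
  intros Ht He Hf eps e0. destruct (Hf eps e0) as [d [d0 Hd]]. exists d; split; [exact d0|].
  intros s Hs Hst. rewrite <- !He by assumption. apply Hd; assumption.
Qed.

Lemma is_tderiv_minus (f g : R -> C) (t : R) (l m : C) :
  is_tderiv f t l -> is_tderiv g t m -> is_tderiv (fun s => f s - g s)%C t (l - m)%C.
Proof.
  intros Hf Hg eps e0.
  destruct (Hf (eps / 2)) as [d1 [d10 Hd1]]; [lra|].
  destruct (Hg (eps / 2)) as [d2 [d20 Hd2]]; [lra|].
  exists (Rmin d1 d2). split; [apply Rmin_glb_lt; assumption|]. intros s Hs Hst.
  assert (H1 := Hd1 s Hs (Rlt_le_trans _ _ _ Hst (Rmin_l _ _))).
  assert (H2 := Hd2 s Hs (Rlt_le_trans _ _ _ Hst (Rmin_r _ _))).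
  replace (f s - g s - (f t - g t) - RtoC (s - t) * (l - m))%C with
    ((f s - f t - RtoC (s - t) * l) - (g s - g t - RtoC (s - t) * m))%C by ring.
  eapply Rle_trans; [apply Cmod_minus_le|]. lra.
Qed.

Lemma is_tderiv_affine (c z : C) (f : R -> C) (t : R) (l : C) :
  is_tderiv f t l -> is_tderiv (fun s => z + c * f s)%C t (c * l)%C.
Proof.
  intros Hf eps e0. assert (Hc := Cmod_ge_0 c).
  destruct (Hf (eps / (1 + Cmod c))) as [d [d0 Hd]]; [apply Rdiv_lt_0_compat; lra|].
  exists d. split; [exact d0|]. intros s Hs Hst. specialize (Hd s Hs Hst).
  replace (z + c * f s - (z + c * f t) - RtoC (s - t) * (c * l))%C with
    (c * (f s - f t - RtoC (s - t) * l))%C by ring.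
  rewrite Cmod_mult. assert (Hp := Rabs_pos (s - t)).
  assert (Hq : 0 < eps / (1 + Cmod c)) by (apply Rdiv_lt_0_compat; lra).
  assert (E : eps = eps / (1 + Cmod c) * (1 + Cmod c)) by (field; lra).
  eapply Rle_trans; [apply Rmult_le_compat_l; [exact Hc | exact Hd]|].
  rewrite E at 2. set (q := eps / (1 + Cmod c)) in *.
  replace (q * (1 + Cmod c) * Rabs (s - t)) with (q * Rabs (s - t) + Cmod c * (q * Rabs (s - t))) by ring.
  assert (0 <= q * Rabs (s - t)) by (apply Rmult_le_pos; lra). lra.
Qed.

Lemma is_tderiv_comp (G : C -> C) (p : R -> C) (t : R) (l D : C) :
  is_tderiv p t l -> is_cderiv G (p t) D -> is_tderiv (fun s => G (p s)) t (D * l)%C.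
Proof.
  intros Hp HG eps e0. rewrite is_cderiv_eps in HG.
  assert (Hl0 := Cmod_ge_0 l). assert (HD0 := Cmod_ge_0 D).
  (* The remainder of [G] contributes [eta * (Cmod l + 1)] and [D] times that of [p] contributes
     [eta * Cmod D], both per unit of [Rabs (s - t)]; [S] collects the two factors. *)
  set (S := Cmod l + 1 + Cmod D). assert (S0 : 0 < S) by (unfold S; lra).
  set (eta := Rmin 1 (eps / S)).
  assert (eta0 : 0 < eta) by (apply Rmin_glb_lt; [lra | apply Rdiv_lt_0_compat; lra]).
  assert (eta1 : eta <= 1) by apply Rmin_l.
  assert (eta2 : eta * S <= eps).
  { replace eps with (eps / S * S) by (field; lra). apply Rmult_le_compat_r; [lra | apply Rmin_r]. }
  destruct (HG eta eta0) as [d1 [d10 Hd1]]. destruct (Hp eta eta0) as [d2 [d20 Hd2]].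
  exists (Rmin d2 (d1 / (Cmod l + 2))). split.
  { apply Rmin_glb_lt; [exact d20 | apply Rdiv_lt_0_compat; lra]. }
  intros s Hs Hst.
  assert (Hst2 : Rabs (s - t) < d2) by (eapply Rlt_le_trans; [exact Hst | apply Rmin_l]).
  assert (Hst1 : Rabs (s - t) * (Cmod l + 2) < d1).
  { replace d1 with (d1 / (Cmod l + 2) * (Cmod l + 2)) by (field; lra).
    apply Rmult_lt_compat_r; [lra|]. eapply Rlt_le_trans; [exact Hst | apply Rmin_r]. }
  specialize (Hd2 s Hs Hst2).
  assert (Hx := Rabs_pos (s - t)).
  assert (HDelta : Cmod (p s - p t) <= (Cmod l + 1) * Rabs (s - t)).
  { assert (H := Cmod_triangle_sub (p s - p t) (RtoC (s - t) * l)).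
    rewrite Cmod_mult, Cmod_R in H. nra. }
  specialize (Hd1 (p s) ltac:(nra)).
  replace (G (p s) - G (p t) - RtoC (s - t) * (D * l))%C with
    ((G (p s) - G (p t) - D * (p s - p t)) + D * (p s - p t - RtoC (s - t) * l))%C by ring.
  eapply Rle_trans; [apply Cmod_triangle|]. rewrite Cmod_mult.
  apply Rle_trans with (eta * S * Rabs (s - t)); [|apply Rmult_le_compat_r; assumption].
  unfold S.
  apply Rle_trans with (eta * ((Cmod l + 1) * Rabs (s - t)) + Cmod D * (eta * Rabs (s - t))).
  - apply Rplus_le_compat; [|apply Rmult_le_compat_l; assumption].
    eapply Rle_trans; [exact Hd1|]. apply Rmult_le_compat_l; lra.
  - right; ring.
Qed.

(* No local injectivity of [G] is needed: the difference quotients of [G o p] and of [p]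
   are compared directly, [p] being continuous. *)
Lemma is_tderiv_inverse (G : C -> C) (p : R -> C) (t : R) (m D : C) :
  continuous (U := C_UniformSpace) p t -> is_tderiv (fun s => G (p s)) t m ->
  is_cderiv G (p t) D -> D <> 0%C -> is_tderiv p t (m * / D)%C.
Proof.
  intros Hpc HGp HG HD eps e0. rewrite is_cderiv_eps in HG. rewrite continuous_RC_eps in Hpc.
  assert (HDp : 0 < Cmod D) by (apply Cmod_gt_0, HD).
  set (q := Cmod (m * / D)). assert (q0 : 0 <= q) by apply Cmod_ge_0.
  set (eta := Rmin (1 / 2) (eps / (2 * q + 2))).
  assert (eta0 : 0 < eta) by (apply Rmin_glb_lt; [lra | apply Rdiv_lt_0_compat; lra]).
  assert (eta1 : eta <= 1 / 2) by apply Rmin_l.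
  assert (eta2 : eta * (2 * q + 2) <= eps).
  { replace eps with (eps / (2 * q + 2) * (2 * q + 2)) by (field; lra).
    apply Rmult_le_compat_r; [lra | apply Rmin_r]. }
  assert (etaD : 0 < eta * Cmod D) by (apply Rmult_lt_0_compat; assumption).
  destruct (HG _ etaD) as [d1 [d10 Hd1]]. destruct (HGp _ etaD) as [d2 [d20 Hd2]].
  destruct (Hpc d1 d10) as [d3 [d30 Hd3]].
  exists (Rmin d2 d3). split; [apply Rmin_glb_lt; assumption|].
  intros s Hs Hst.
  assert (H2 := Hd2 s Hs (Rlt_le_trans _ _ _ Hst (Rmin_l _ _))).
  assert (H1 := Hd1 (p s) (Hd3 s (Rlt_le_trans _ _ _ Hst (Rmin_r _ _)))).
  assert (Hx := Rabs_pos (s - t)). assert (Hy := Cmod_ge_0 (p s - p t)).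
  set (Del := (p s - p t)%C) in *. set (x := Rabs (s - t)) in *.
  set (err := (Del - RtoC (s - t) * (m * / D))%C).
  assert (HE : Cmod err <= eta * (Cmod Del + x)).
  { apply (Rmult_le_reg_l (Cmod D)); [exact HDp|]. rewrite <- Cmod_mult.
    replace (D * err)%C with ((G (p s) - G (p t) - RtoC (s - t) * m)
      - (G (p s) - G (p t) - D * Del))%C by (unfold err; field; exact HD).
    eapply Rle_trans; [apply Cmod_minus_le|]. lra. }
  (* Since [eta <= 1 / 2], the term [eta * Cmod Del] of the error is absorbed on the left. *)
  assert (HDel : Cmod Del <= (2 * q + 1) * x).
  { assert (H := Cmod_triangle_sub Del (RtoC (s - t) * (m * / D))). fold err in H.
    rewrite Cmod_mult, Cmod_R in H. fold q x in H. nra. }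
  eapply Rle_trans; [exact HE|].
  apply Rle_trans with (eta * ((2 * q + 2) * x)).
  - apply Rmult_le_compat_l; lra.
  - rewrite <- Rmult_assoc. apply Rmult_le_compat_r; assumption.
Qed.

(** The source of differentiability in time: the integral over a moving window is differentiable
    although [g] is merely continuous. *)
Lemma is_rderiv_window (g : R -> C) (h t : R) :
  (forall s, continuous (U := C_UniformSpace) g s) ->
  is_rderiv (fun s => CInt g s (s + h)) t (g (t + h)%R - g t)%C.
Proof.
  intros Hg.
  assert (HI : forall s, is_rderiv (fun u => CInt g 0 u) s (g s)).
  { intros s. apply (is_derive_RInt (V := C_R_NormedModule) g (fun u => CInt g 0 u) 0 s).
    - exists (mkposreal 1 Rlt_0_1). intros u _. apply CInt_correct, ex_CInt_continuous, Hg.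
    - apply Hg. }
  assert (E : forall s, CInt g s (s + h) = (CInt g 0 (s + h)%R - CInt g 0 s)%C :> C).
  { intros s. rewrite (CInt_Chasles g 0 s (s + h)) by (apply ex_CInt_continuous, Hg).
    symmetry. ring. }
  apply is_rderiv_eps. intros eps e0.
  destruct (proj1 (is_rderiv_eps _ _ _) (HI t) (eps / 2) ltac:(lra)) as [d1 [d10 Hd1]].
  destruct (proj1 (is_rderiv_eps _ _ _) (HI (t + h)) (eps / 2) ltac:(lra)) as [d2 [d20 Hd2]].
  exists (Rmin d1 d2). split; [apply Rmin_glb_lt; assumption|]. intros s Hst.
  assert (H1 := Hd1 s (Rlt_le_trans _ _ _ Hst (Rmin_l _ _))).
  specialize (Hd2 (s + h)). replace (s + h - (t + h)) with (s - t) in Hd2 by ring.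
  assert (H2 := Hd2 (Rlt_le_trans _ _ _ Hst (Rmin_r _ _))).
  rewrite !E.
  match type of H1 with Cmod ?X <= _ => match type of H2 with Cmod ?Y <= _ =>
    match goal with |- Cmod ?Z <= _ => replace Z with (Y - X)%C by ring end end end.
  eapply Rle_trans; [apply Cmod_minus_le|]. lra.
Qed.

Lemma CInt_shift (g : R -> C) (h t : R) : (forall s, continuous (U := C_UniformSpace) g s) ->
  is_CInt (fun s => g (s + t)%R) 0 h (CInt g t (t + h)).
Proof.
  intros Hg. assert (I := CInt_correct _ _ _ (ex_CInt_continuous g t (t + h) Hg)).
  replace t with (1 * 0 + t) in I at 1 by ring. replace (t + h) with (1 * h + t) in I at 1 by ring.
  apply (is_RInt_comp_lin (V := C_R_NormedModule)) in I.
  eapply is_RInt_ext; [|exact I]. intros x _. cbv beta.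
  rewrite Rmult_1_l. exact (scal_one (K := R_Ring) (V := C_R_ModuleSpace) (g (x + t))).
Qed.

(** * Generators *)

(** Rests on [Rmax 0] being 1-Lipschitz with values in [[0, oo)]. *)
Lemma family_continuous_extend (U : C -> Prop) (G : R -> C -> C) :
  jointly_continuous_on U G -> family_continuous U (fun s => G (Rmax 0 s)).
Proof.
  intros HG t z Hz eps e0.
  destruct (HG (Rmax 0 t) z (Rmax_l 0 t) Hz (fun w => Cmod (w - G (Rmax 0 t) z) < eps))
    as [d Hd].
  { apply locally_C_Cmod. exists eps; split; [exact e0 | tauto]. }
  exists d. split; [apply cond_pos|]. intros s w Hs Hw HUw.
  apply (Hd (Rmax 0 s, w)).
  - split; [|apply C_NormedModule_mixin_compat1; exact Hw].
    change (Rabs (Rmax 0 s - Rmax 0 t) < d). eapply Rle_lt_trans; [|exact Hs].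
    unfold Rmax. destruct (Rle_dec 0 s); destruct (Rle_dec 0 t);
      unfold Rabs; repeat destruct Rcase_abs; lra.
  - split; [apply Rmax_l | exact HUw].
Qed.

Section Flow.

Variables (U : C -> Prop) (F H : R -> C -> C).
Hypothesis HUo : forall z, U z -> exists d, 0 < d /\ forall w, Cmod (w - z) < d -> U w.
Hypothesis HFa : forall t, 0 <= t -> analytic_on U (F t).
Hypothesis HHa : forall t, 0 <= t -> analytic_on U (H t).
Hypothesis HF0 : forall z, U z -> F 0 z = z.
Hypothesis HFs : forall s t z, 0 <= s -> 0 <= t -> U z -> F (t + s) z = F t (F s z).
Hypothesis HHs : forall s t z, 0 <= s -> 0 <= t -> U z ->
  H (t + s) z = Cplus (Cminus (H t (F s z)) (F s z)) (H s z).
Hypothesis HFc : jointly_continuous_on U F.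
Hypothesis HHc : jointly_continuous_on U H.

(* Constant extension to negative times, which makes all time integrands continuous on [R]. *)
Let Fe (s : R) (z : C) : C := F (Rmax 0 s) z.
Let Ke (s : R) (z : C) : C := (H (Rmax 0 s) z - z)%C.

Lemma Fe_pos (s : R) (z : C) : 0 <= s -> Fe s z = F s z.
Proof. intros Hs. unfold Fe. rewrite Rmax_right by exact Hs. reflexivity. Qed.

Lemma Ke_pos (s : R) (z : C) : 0 <= s -> Ke s z = (H s z - z)%C.
Proof. intros Hs. unfold Ke. rewrite Rmax_right by exact Hs. reflexivity. Qed.

Lemma Fe_continuous : family_continuous U Fe.
Proof. exact (family_continuous_extend U F HFc). Qed.

Lemma Ke_continuous : family_continuous U Ke.
Proof.
  intros t z Hz eps e0.
  destruct (family_continuous_extend U H HHc t z Hz (eps / 2)) as [d [d0 Hd]]; [lra|].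
  exists (Rmin d (eps / 2)). split; [apply Rmin_glb_lt; lra|].
  intros s w Hs Hw HUw. unfold Ke.
  assert (H1 := Hd s w (Rlt_le_trans _ _ _ Hs (Rmin_l _ _)) (Rlt_le_trans _ _ _ Hw (Rmin_l _ _)) HUw).
  assert (H2 := Rlt_le_trans _ _ _ Hw (Rmin_r _ _)).
  replace (H (Rmax 0 s) w - w - (H (Rmax 0 t) z - z))%C
    with ((H (Rmax 0 s) w - H (Rmax 0 t) z) - (w - z))%C by ring.
  eapply Rle_lt_trans; [apply Cmod_minus_le|]. cbv beta in H1. lra.
Qed.

Lemma Fe_analytic (t : R) (z : C) : U z -> ex_cderiv (Fe t) z.
Proof. intros Hz. exact (HFa (Rmax 0 t) (Rmax_l 0 t) z Hz). Qed.

Lemma Ke_analytic (t : R) (z : C) : U z -> ex_cderiv (Ke t) z.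
Proof.
  intros Hz. apply ex_cderiv_minus; [|apply ex_cderiv_id].
  exact (HHa (Rmax 0 t) (Rmax_l 0 t) z Hz).
Qed.

Lemma Fe_time_continuous (z : C) : U z -> forall t, continuous (U := C_UniformSpace) (fun s => Fe s z) t.
Proof. intros Hz t. exact (family_continuous_time U Fe Fe_continuous z t Hz). Qed.

Lemma Ke_time_continuous (z : C) : U z -> forall t, continuous (U := C_UniformSpace) (fun s => Ke s z) t.
Proof. intros Hz t. exact (family_continuous_time U Ke Ke_continuous z t Hz). Qed.

Lemma Ke_cocycle (s t : R) (z : C) : 0 <= s -> 0 <= t -> U z ->
  Ke s (F t z) = (Ke (s + t)%R z - Ke t z)%C.
Proof.
  intros Hs Ht Hz. rewrite !Ke_pos by lra. rewrite HHs by assumption. ring.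
Qed.

Lemma time_int_flow (h t : R) (z : C) : 0 < h -> 0 <= t -> U z ->
  time_int Fe h (F t z) = CInt (fun s => Fe s z) t (t + h).
Proof.
  intros Hh Ht Hz. unfold time_int. apply is_CInt_unique.
  eapply is_RInt_ext; [|exact (CInt_shift (fun s => Fe s z) h t (Fe_time_continuous z Hz))].
  rewrite Rmin_left, Rmax_right by lra. intros s Hs. cbv beta.
  rewrite !Fe_pos by lra. rewrite HFs by lra || assumption. reflexivity.
Qed.

Lemma time_int_cocycle (h t : R) (z : C) : 0 < h -> 0 <= t -> U z ->
  time_int Ke h (F t z) = (CInt (fun s => Ke s z) t (t + h)%R - RtoC h * Ke t z)%C.
Proof.
  intros Hh Ht Hz. unfold time_int. apply is_CInt_unique.
  assert (I1 := CInt_shift (fun s => Ke s z) h t (Ke_time_continuous z Hz)).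
  assert (I2 : is_CInt (fun _ => (- Ke t z)%C) 0 h (RtoC h * - Ke t z)%C).
  { assert (I := is_RInt_const (V := C_R_NormedModule) 0 h (- Ke t z)%C).
    change (scal (h - 0) (- Ke t z)%C)
      with (@scal R_Ring C_R_ModuleSpace (h - 0) (- Ke t z)%C) in I.
    rewrite scal_R_Cmult, Rminus_0_r in I. exact I. }
  assert (I := is_CInt_plus _ _ _ _ _ _ I1 I2).
  replace (CInt (fun s => Ke s z) t (t + h)%R - RtoC h * Ke t z)%C
    with (CInt (fun s => Ke s z) t (t + h)%R + RtoC h * - Ke t z)%C by ring.
  eapply is_RInt_ext; [|exact I].
  rewrite Rmin_left, Rmax_right by lra. intros s Hs. cbv beta.
  rewrite Ke_cocycle by lra || assumption. reflexivity.
Qed.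

Lemma is_tderiv_flow (h t : R) (z : C) : 0 < h -> 0 <= t -> U z ->
  ex_cderiv (time_int Fe h) (F t z) -> C_derive (time_int Fe h) (F t z) <> 0%C ->
  is_tderiv (fun s => F s z) t
    ((F h (F t z) - F t z) * / C_derive (time_int Fe h) (F t z))%C.
Proof.
  intros Hh Ht Hz HG HD.
  assert (HG' : is_cderiv (time_int Fe h) (F t z) (C_derive (time_int Fe h) (F t z)))
    by (apply C_derive_correct; [exact z | exact HG]).
  apply (is_tderiv_ext (fun s => Fe s z)); [exact Ht | intros; apply Fe_pos; assumption|].
  apply (is_tderiv_inverse (time_int Fe h) (fun s => Fe s z)).
  - apply Fe_time_continuous, Hz.
  - apply (is_rderiv_is_tderiv (fun s => CInt (fun u => Fe u z) s (s + h))); [exact Ht| |].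
    + intros s Hs. rewrite Fe_pos by exact Hs. rewrite time_int_flow by assumption. reflexivity.
    + assert (W := is_rderiv_window (fun u => Fe u z) h t (Fe_time_continuous z Hz)).
      cbv beta in W. rewrite !Fe_pos in W by lra.
      (* By the semigroup law [F (h + t) z] is [F h (F t z)], so the derivative depends on [t] and
         [z] only through the point [F t z]. *)
      rewrite Rplus_comm, HFs in W by lra || assumption.
      exact W.
  - rewrite Fe_pos by exact Ht. exact HG'.
  - exact HD.
Qed.

Lemma is_tderiv_cocycle (h t : R) (z l : C) : 0 < h -> 0 <= t -> U z ->
  ex_cderiv (time_int Ke h) (F t z) -> is_tderiv (fun s => F s z) t l ->
  is_tderiv (fun s => H s z) t
    (/ RtoC h * (Ke h (F t z) - C_derive (time_int Ke h) (F t z) * l))%C.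
Proof.
  intros Hh Ht Hz HM HF.
  assert (HM' : is_cderiv (time_int Ke h) (F t z) (C_derive (time_int Ke h) (F t z)))
    by (apply C_derive_correct; [exact z | exact HM]).
  assert (Hc : RtoC h <> 0%C) by (intros E; apply (f_equal fst) in E; simpl in E; lra).
  (* The averaged cocycle identity is solved for [H s z]; the window integral and the composite with
     the flow are then differentiated separately. *)
  apply (is_tderiv_ext (fun s => z + / RtoC h *
    (CInt (fun u => Ke u z) s (s + h)%R - time_int Ke h (F s z)))%C); [exact Ht | |].
  { intros s Hs. rewrite time_int_cocycle by assumption. rewrite (Ke_pos s z Hs). field. exact Hc. }
  apply is_tderiv_affine. apply is_tderiv_minus.
  - apply (is_rderiv_is_tderiv (fun s => CInt (fun u => Ke u z) s (s + h))); [exact Ht | auto |].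
    rewrite Ke_cocycle, (Rplus_comm h t) by lra || assumption.
    apply (is_rderiv_window (fun u => Ke u z)), Ke_time_continuous, Hz.
  - apply (is_tderiv_comp (time_int Ke h) (fun s => F s z)); assumption.
Qed.

(** The formulas hold for every orbit at every time at which it passes near [a], because [h] is
    fixed by [a] alone. *)
Lemma local_generators (a : C) : U a -> exists (B1 B2 : C -> C) (d : R), 0 < d /\
  ex_cderiv B1 a /\ ex_cderiv B2 a /\
  forall t z, 0 <= t -> U z -> Cmod (F t z - a) < d ->
    is_tderiv (fun s => H s z) t (B1 (F t z)) /\ is_tderiv (fun s => F s z) t (B2 (F t z)).
Proof.
  intros Ha.
  destruct (ex_cderiv_time_int U Fe Fe_continuous Fe_analytic HUo a Ha) as [d1 [d10 Hd1]].
  destruct (ex_cderiv_time_int U Ke Ke_continuous Ke_analytic HUo a Ha) as [d2 [d20 Hd2]].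
  destruct (time_int_deriv_neq_0 U Fe Fe_continuous Fe_analytic HUo a Ha) as [d3 [d30 Hd3]].
  { intros z Hz. rewrite Fe_pos by lra. apply HF0, Hz. }
  set (m := Rmin d1 (Rmin d2 d3)).
  assert (Hm1 : m <= d1) by apply Rmin_l.
  assert (Hm2 : m <= d2) by (eapply Rle_trans; [apply Rmin_r | apply Rmin_l]).
  assert (Hm3 : m <= d3) by (eapply Rle_trans; [apply Rmin_r | apply Rmin_r]).
  assert (m0 : 0 < m) by (repeat apply Rmin_glb_lt; assumption).
  set (h := m / 2). assert (Hh : 0 < h < m) by (unfold h; lra).
  set (DF := C_derive (time_int Fe h)). set (DK := C_derive (time_int Ke h)).
  assert (HDF : ex_cderiv DF a)
    by (apply (ex_cderiv_C_derive _ a d1 d10); intros; apply Hd1; lra).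
  assert (HDK : ex_cderiv DK a)
    by (apply (ex_cderiv_C_derive _ a d2 d20); intros; apply Hd2; lra).
  assert (HDa : DF a <> 0%C) by (apply Hd3; lra).
  (* Within [d4] of [a] the values of [DF] differ from [DF a] by less than [Cmod (DF a)], so they
     cannot vanish. *)
  destruct (ex_cderiv_cont DF a HDF (Cmod (DF a))) as [d4 [d40 Hd4]];
    [apply Cmod_gt_0, HDa|].
  assert (HB2 : ex_cderiv (fun w => (F h w - w) * / DF w)%C a).
  { apply ex_cderiv_mult; [|apply ex_cderiv_inv; assumption].
    apply ex_cderiv_minus; [|apply ex_cderiv_id]. apply HFa; [lra | exact Ha]. }
  exists (fun w => / RtoC h * (Ke h w - DK w * ((F h w - w) * / DF w)))%C,
    (fun w => (F h w - w) * / DF w)%C, (Rmin m d4).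
  split; [apply Rmin_glb_lt; assumption|]. split; [|split; [exact HB2|]].
  { apply ex_cderiv_mult; [apply ex_cderiv_const|].
    apply ex_cderiv_minus; [apply Ke_analytic, Ha|]. apply ex_cderiv_mult; assumption. }
  intros t z Ht Hz Hw.
  assert (Hw1 : Cmod (F t z - a) < m) by (eapply Rlt_le_trans; [exact Hw | apply Rmin_l]).
  assert (Hw2 : Cmod (F t z - a) < d4) by (eapply Rlt_le_trans; [exact Hw | apply Rmin_r]).
  assert (HDw : DF (F t z) <> 0%C).
  { intros E. specialize (Hd4 _ Hw2). rewrite E in Hd4.
    replace (0 - DF a)%C with (- DF a)%C in Hd4 by ring. rewrite Cmod_opp in Hd4. lra. }
  assert (HF : is_tderiv (fun s => F s z) t ((F h (F t z) - F t z) * / DF (F t z))%C).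
  { apply is_tderiv_flow; try assumption; try lra. apply Hd1; lra. }
  split; [|exact HF].
  apply is_tderiv_cocycle; try assumption; try lra. apply Hd2; lra.
Qed.

End Flow.

(** * Gluing the local generators *)

Theorem theorem4p2 (U : C -> Prop) (F H : R -> C -> C) :
  open U ->
  (forall t : R, 0 <= t -> analytic_on U (F t)) ->
  (forall t : R, 0 <= t -> analytic_on U (H t)) ->
  (forall (t : R) (z : C), 0 <= t -> U z -> U (F t z)) ->
  (forall (t : R) (z : C), 0 <= t -> U z -> U (H t z)) ->
  (forall z : C, U z -> F 0 z = z) ->
  (forall z : C, U z -> H 0 z = z) ->
  (forall (s t : R) (z : C), 0 <= s -> 0 <= t -> U z ->
     F (t + s) z = F t (F s z)) ->
  (forall (s t : R) (z : C), 0 <= s -> 0 <= t -> U z ->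
     H (t + s) z = Cplus (Cminus (H t (F s z)) (F s z)) (H s z)) ->
  jointly_continuous_on U F ->
  jointly_continuous_on U H ->
  exists A1 A2 : C -> C,
    analytic_on U A1 /\ analytic_on U A2 /\
    forall (t : R) (z : C), 0 <= t -> U z ->
      has_tderiv (fun s : R => H s z) t (A1 (F t z)) /\
      has_tderiv (fun s : R => F s z) t (A2 (F t z)).
Proof.
  intros HU HFa HHa HFU _ HF0 _ HFs HHs HFc HHc.
  assert (HUo : forall z, U z -> exists d, 0 < d /\ forall w, Cmod (w - z) < d -> U w)
    by (intros z Hz; apply locally_C_Cmod, HU, Hz).
  assert (Hloc := local_generators U F H HUo HFa HHa HF0 HFs HHs HFc HHc).
  (* The global generators are defined as the derivatives at time 0 of [H] and [F] along the orbit
     of [w], with [(w, w)] as default value outside [U]. *)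
  assert (HA : forall w, exists A : C * C, U w ->
    is_tderiv (fun s => H s w) 0 (fst A) /\ is_tderiv (fun s => F s w) 0 (snd A)).
  { intros w. destruct (classic (U w)) as [Hw | Hw]; [|exists (w, w); tauto].
    destruct (Hloc w Hw) as [B1 [B2 [d [d0 [_ [_ Hd]]]]]].
    exists (B1 w, B2 w). intros _. specialize (Hd 0 w (Rle_refl 0) Hw).
    rewrite (HF0 w Hw), Cmod_minus_diag in Hd. exact (Hd d0). }
  set (A := fun w => proj1_sig (constructive_indefinite_description _ (HA w))).
  assert (HAw : forall w, U w ->
    is_tderiv (fun s => H s w) 0 (fst (A w)) /\ is_tderiv (fun s => F s w) 0 (snd (A w)))
    by (intros w; exact (proj2_sig (constructive_indefinite_description _ (HA w)))).
  clearbody A.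
  (* At time 0 the flow is the identity, so near [a] both the local formulas and [A] are time
     derivatives of the same functions and agree by uniqueness; the disc is shrunk to lie in [U].
     Holomorphy of the local formulas then passes to [A]. *)
  assert (Hgen : forall a, U a -> exists (B1 B2 : C -> C) (d : R), 0 < d /\
    ex_cderiv B1 a /\ ex_cderiv B2 a /\
    (forall w, Cmod (w - a) < d -> B1 w = fst (A w) /\ B2 w = snd (A w)) /\
    forall t z, 0 <= t -> U z -> Cmod (F t z - a) < d ->
      is_tderiv (fun s => H s z) t (B1 (F t z)) /\ is_tderiv (fun s => F s z) t (B2 (F t z))).
  { intros a Ha. destruct (Hloc a Ha) as [B1 [B2 [d [d0 [HB1 [HB2 Hd]]]]]].
    destruct (HUo a Ha) as [e [e0 He]].
    assert (Hm1 := Rmin_l d e). assert (Hm2 := Rmin_r d e).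
    exists B1, B2, (Rmin d e). split; [apply Rmin_glb_lt; assumption|].
    split; [exact HB1|]. split; [exact HB2|]. split.
    - intros w Hw. assert (HUw : U w) by (apply He; lra).
      specialize (Hd 0 w (Rle_refl 0) HUw). rewrite (HF0 w HUw) in Hd.
      destruct (Hd ltac:(lra)) as [K1 K2]. destruct (HAw w HUw) as [L1 L2].
      split; eapply is_tderiv_unique; try eassumption; lra.
    - intros t z Ht Hz Hw. apply Hd; auto. lra. }
  exists (fun w => fst (A w)), (fun w => snd (A w)). repeat split.
  - intros a Ha. destruct (Hgen a Ha) as [B1 [B2 [d [d0 [HB1 [HB2 [HE _]]]]]]].
    apply (ex_cderiv_ext_loc B1 _ a d d0); [|exact HB1]. intros w Hw; apply HE, Hw.
  - intros a Ha. destruct (Hgen a Ha) as [B1 [B2 [d [d0 [HB1 [HB2 [HE _]]]]]]].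
    apply (ex_cderiv_ext_loc B2 _ a d d0); [|exact HB2]. intros w Hw; apply HE, Hw.
  (* The local generators are centred at [F t z] itself, which lies in [U] by invariance, so the
     distance condition reads [0 < d]. *)
  - destruct (Hgen (F t z) (HFU t z H0 H1)) as [B1 [B2 [d [d0 [_ [_ [HE Hd]]]]]]].
    apply is_tderiv_has_tderiv.
    assert (Hz : Cmod (F t z - F t z) < d) by (rewrite Cmod_minus_diag; exact d0).
    rewrite <- (proj1 (HE _ Hz)). apply Hd; assumption.
  - destruct (Hgen (F t z) (HFU t z H0 H1)) as [B1 [B2 [d [d0 [_ [_ [HE Hd]]]]]]].
    apply is_tderiv_has_tderiv.
    assert (Hz : Cmod (F t z - F t z) < d) by (rewrite Cmod_minus_diag; exact d0).
    rewrite <- (proj2 (HE _ Hz)). apply Hd; assumption.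
Qed.
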